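(* Let $M,N,m\ge 1$ be integers, and let $\psi_a(n,\mathbf t,z),\psi_a^*(n,\mathbf t,z)$ ($a=1,2$), $q^{(i)}_n(\mathbf t)$, $r^{(i)}_n(\mathbf t)$ ($n\in\mathbb Z$, $1\le i\le m$) be defined from functions $\tau_{0,n}(\mathbf t)$, $\tau^{(i)}_{1,n}(\mathbf t)$, $\tau^{(i)}_{-1,n}(\mathbf t)$ of $\mathbf t=(t^{(1)},t^{(2)})$ as in the context. Suppose that the following bilinear equations hold for all $n',n''\in\mathbb Z$, all $\mathbf t',\mathbf t''$ and all $1\le i\le m$: \begin{align*} \sum_{l=1}^m q_{n'}^{(l)}(\mathbf t')\,r_{n''}^{(l)}(\mathbf t'') &=\oint_{C_R}\frac{dz}{2\pi \mathbf i}z^{M-1}\psi_1(n',\mathbf t',z)\psi_1^*(n'',\mathbf t'',z) -\oint_{C_r}\frac{dz}{2\pi \mathbf i}z^{-N-1}\psi_2(n',\mathbf t',z)\psi_2^*(n'',\mathbf t'',z),\\ q^{(i)}_{n'}(\mathbf t') &=-\oint_{C_R}\frac{dz}{2\pi \mathbf i}z^{-1}\psi_1(n',\mathbf t',z)\,\iota_{\Lambda}(\Lambda-1)^{-1}\Big(\psi_1^*(n''+1,\mathbf t'',z)q^{(i)}_{n''}(\mathbf t'')\Big)\\ &\quad+\oint_{C_r}\frac{dz}{2\pi \mathbf i}z^{-1}\psi_2(n',\mathbf t',z)\,\iota_{\Lambda^{-1}}(\Lambda-1)^{-1}\Big(\psi_2^*(n''+1,\mathbf t'',z)q^{(i)}_{n''}(\mathbf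 t'')\Big),\\ r^{(i)}_{n'}(\mathbf t') &=\oint_{C_R}\frac{dz}{2\pi \mathbf i}z^{-1}\psi_1^*(n',\mathbf t',z)\,\iota_{\Lambda^{-1}}(\Lambda-1)^{-1}\Big(\psi_1(n'',\mathbf t'',z)r^{(i)}_{n''+1}(\mathbf t'')\Big)\\ &\quad-\oint_{C_r}\frac{dz}{2\pi \mathbf i}z^{-1}\psi_2^*(n',\mathbf t',z)\,\iota_{\Lambda}(\Lambda-1)^{-1}\Big(\psi_2(n'',\mathbf t'',z)r^{(i)}_{n''+1}(\mathbf t'')\Big). \end{align*} Let $S_1=1+\sum_{j\ge1}\omega_j(n,\mathbf t)\Lambda^{-j}$ and $S_2=\sum_{j\ge0}\nu_j(n,\mathbf t)\Lambda^{j}$ be the operators determined by $$\psi_1(n,\mathbf t,z)=\big(S_1e^{\xi(t^{(1)},\Lambda)}\big)(z^n),\qquad \psi_2(n,\mathbf t,z)=\big(S_2e^{\xi(t^{(2)},\Lambda^{-1})}\big)(z^n),$$ and set $L_1(n)=S_1\Lambda S_1^{-1}$, $L_2(n)=S_2\Lambda^{-1}S_2^{-1}$. Then $$L_1^M(n)=L_2^{N}(n)+\sum_{j\in\mathbb Z}\sum_{i=1}^{m}q^{(i)}_n\Lambda^j r^{(i)}_{n+1},$$ and for all $p\ge1$, $a=1,2$, $1\le i\le m$, \begin{align*} &\partial_{t^{(1)}_p}L_a(n)=[(L_1^p(n))_{\ge0},L_a(n)],\qquad \partial_{t^{(2)}_p}L_a(n)=[(L_2^p(n))_{<0},L_a(n)],\\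 &\partial_{t^{(1)}_p}q^{(i)}_n=\big(L_1^{p}(n)\big)_{\ge0}\big(q^{(i)}_n\big),\qquad \partial_{t^{(2)}_p}q^{(i)}_n=\big(L_2^{p}(n)\big)_{<0}\big(q^{(i)}_n\big),\\ &\partial_{t^{(1)}_p}r^{(i)}_n=-\Big(\big(L_1^{p}(n-1)\big)_{\ge0}\Big)^*\big(r^{(i)}_n\big),\qquad \partial_{t^{(2)}_p}r^{(i)}_n=-\Big(\big(L_2^{p}(n-1)\big)_{<0}\Big)^*\big(r^{(i)}_n\big). \end{align*}
   Context: Variables: $\mathbf t=(t^{(1)},t^{(2)})$, $t^{(a)}=(t^{(a)}_1,t^{(a)}_2,\dots)$; functions of $\mathbf t$ are treated formally. $\xi(t,z)=\sum_{j\ge1}t_jz^j$, $[z]=(z,z^2/2,z^3/3,\dots)$, $\mathbf t\pm[z]_1=(t^{(1)}\pm[z],t^{(2)})$, $\mathbf t\pm[z]_2=(t^{(1)},t^{(2)}\pm[z])$. Definitions: $\psi_1(n,\mathbf t,z)=\frac{\tau_{0,n}(\mathbf t-[z^{-1}]_1)}{\tau_{0,n}(\mathbf t)}z^ne^{\xi(t^{(1)},z)}$, $\psi_2(n,\mathbf t,z)=\frac{\tau_{0,n+1}(\mathbf t-[z]_2)}{\tau_{0,n}(\mathbf t)}z^ne^{\xi(t^{(2)},z^{-1})}$, $\psi_1^*(n,\mathbf t,z)=\frac{\tau_{0,n}(\mathbf t+[z^{-1}]_1)}{\tau_{0,n}(\mathbf t)}z^{-n+1}e^{-\xi(t^{(1)},z)}$,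 $\psi_2^*(n,\mathbf t,z)=\frac{\tau_{0,n-1}(\mathbf t+[z]_2)}{\tau_{0,n}(\mathbf t)}z^{-n+1}e^{-\xi(t^{(2)},z^{-1})}$, $q^{(i)}_n(\mathbf t)=\tau^{(i)}_{1,n}(\mathbf t)/\tau_{0,n}(\mathbf t)$, $r^{(i)}_n(\mathbf t)=\tau^{(i)}_{-1,n}(\mathbf t)/\tau_{0,n}(\mathbf t)$. Contour integrals: $C_R$ (resp. $C_r$) is an anticlockwise circle $|z|=R$ (resp. $|z|=r$) of sufficiently large (resp. small) radius. Formally both integrals mean ''take the coefficient of $z^{-1}$'', where in $C_R$-integrals functions shifted by $[z^{-1}]_1$ are expanded in powers of $z^{-1}$, in $C_r$-integrals functions shifted by $[z]_2$ are expanded in powers of $z$, and the product of the exponentials, e.g. $e^{\xi(t^{(1)'}-t^{(1)''},z)}$ or $e^{\xi(t^{(2)'}-t^{(2)''},z^{-1})}$, is expanded as a formal power series in $\mathbf t'-\mathbf t''$. Shift operators: $\Lambda f(n)=f(n+1)$; $\iota_\Lambda(\Lambda-1)^{-1}=-\sum_{i\ge0}\Lambda^i$ and $\iota_{\Lambda^{-1}}(\Lambda-1)^{-1}=\sum_{i\ge1}\Lambda^{-i}$; in the bilinear equations they act on the variable $n''$. An operator $\sum_ia_i(n)\Lambda^i$ acts by $(\sum_i a_i\Lambda^i)(z^{\pm n})=\sum_ia_iz^{\pm(n+i)}$. For $A=\sum_ia_i\Lambda^i$: $A_{\ge0}=\sum_{i\ge0}a_i\Lambda^i$, $A_{<0}=\sum_{i<0}a_i\Lambda^i$,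 $A^*=\sum_i\Lambda^{-i}a_i$, where functions are multiplication operators and $\Lambda^i f(n)=f(n+i)\Lambda^i$. $L_a(n-1)$ denotes $L_a(n)$ with $n$ replaced by $n-1$ in all coefficients. Equality of operators, including doubly infinite sums $\sum_{j\in\mathbb Z}c_j(n)\Lambda^j$, means equality of all coefficients of $\Lambda^j$.
   Formalization: It is additionally assumed that the functions τ_{1,n}^{(i)}, τ_{-1,n}^{(i)} are not all identically zero; if all q and r vanish, the last two bilinear equations read 0=0 and the conclusion can fail (e.g. for M=N=2). *)

(* Defs.v *)
From HB Require Import structures.
From mathcomp Require Import all_boot all_order all_algebra.
From mathcomp Require Import finmap multiset.
From mathcomp Require Import boolp classical_sets cardinality fsbigop.

Set Implicit Arguments.
Unset Strict Implicit.
Unset Printing Implicit Defensive.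

Import Order.TTheory GRing.Theory Num.Theory.
Local Open Scope classical_set_scope.
Local Open Scope ring_scope.

(* Functions of t = (t1, t2) are treated formally: they are the elements of a
   ring F carrying commuting derivations, one for each time variable. Rings
   of formal power series in t, their fraction fields, and rings of
   meromorphic functions of t are all of this kind.

   Every infinite sum below is a [fsbigop] sum. Such a sum is 0 by convention
   when its support is infinite, but the supports occurring here are finite:
   each wave amplitude is bounded on one side in z, each operator is bounded
   on one side in Lambda, and a given monomial in y occurs in only one
   coefficient (in z) of exp(xi(y, z)). *)

(* (a, j) stands for the time t^(a)_{j+1}: note the shift of j. *)
Definition tvar : choiceType := (bool * nat)%type.
Definition c1 : bool := false.
Definition c2 : bool := true.

(* A multiset alpha of time variables is the monomial y^alpha. *)
Notation monom := ({mset tvar}%mset).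

Definition mfact (al : monom) : nat := (\prod_(i <- finsupp al) (al i)`!)%N.
Definition mdeg (al : monom) : nat := (\sum_(i <- finsupp al) al i)%N.
(* the variable t^(a)_j has weight j *)
Definition mweight (al : monom) : nat :=
  (\sum_(i <- finsupp al) al i * i.2.+1)%N.
Definition in_comp (a : bool) (al : monom) : bool :=
  all (fun i : tvar => i.1 == a) (finsupp al).

Definition is_derivation (F : comUnitRingType) (d : F -> F) : Prop :=
  (forall f g, d (f + g) = d f + d g) /\
  (forall f g, d (f * g) = d f * g + f * d g).

(** ** Formal functions of t, t', t'' *)

Section Formal.
Variables (F : comUnitRingType) (D : tvar -> F -> F).

(* A pair of time arguments t', t'' is encoded by t = t'' and the formal
   variables y = t' - t'': functions of (t', t'') are power series in y with
   coefficients in F, a function f(t'') is a constant in y, and f(t') is its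
   Taylor expansion f(t + y). *)
Definition pser := monom -> F.

Definition pmul (f g : pser) : pser := fun al =>
  \sum_(p \in [set p : monom * monom | msetD p.1 p.2 = al]) f p.1 * g p.2.

Definition mderiv (al : monom) (f : F) : F :=
  foldr (fun i g => iter (al i) (D i) g) f (finsupp al).

Definition at_t' (f : F) : pser := fun al => mderiv al f / (mfact al)%:R.
Definition at_t'' (f : F) : pser := fun al => if al == mset0 then f else 0.

(* Coefficient of w^k in f(t + s[w]_a), i.e. in the Taylor expansion f(t + y)
   evaluated at y^(a)_j = s w^j / j, the other y's being 0. *)
Definition shift (s : F) (a : bool) (f : F) (k : nat) : F :=
  \sum_(al \in [set al : monom | in_comp a al /\ mweight al = k])
    s ^+ mdeg al * (\prod_(i <- finsupp al) (i.2.+1%:R ^- al i)) *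
    (mderiv al f / (mfact al)%:R).

(** ** Laurent series in z: k |-> coefficient of z^k *)

Definition zdown (d : int) (c : nat -> F) : int -> F := fun k =>
  if k <= d then c `|d - k|%N else 0.
Definition zup (d : int) (c : nat -> F) : int -> F := fun k =>
  if d <= k then c `|k - d|%N else 0.

Definition zmul (A B : int -> pser) : int -> pser := fun k al =>
  \sum_(i \in [set: int]) pmul (A i) (B (k - i)) al.

(* exp(s xi(y^(1), z)) for a = 1 and exp(s xi(y^(2), z^-1)) for a = 2, as the
   product over j of the series sum_k (s y^(a)_j z^(+-j))^k / k!. *)
Definition zexp (s : F) (a : bool) : int -> pser := fun k al =>
  if in_comp a al && (k == (if a == c1 then (mweight al)%:Z
                            else - (mweight al)%:Z))
  then s ^+ mdeg al / (mfact al)%:R else 0.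

(* A wave function A(t, z) exp(s xi(t^(a), z^(+-1))) is represented by its
   amplitude A. The exponential is a formal symbol; it is only ever multiplied
   by the opposite exponential at another time, as follows:
   [wave_mul s a u v] is the product
     (u(t', z) exp(s xi(t'^(a), z^(+-1)))) (v(t'', z) exp(- s xi(t''^(a), z^(+-1)))). *)
Definition wave_mul (s : F) (a : bool) (u v : int -> F) : int -> pser :=
  zmul (zmul (fun k => at_t' (u k)) (fun k => at_t'' (v k))) (zexp s a).

(* the integral of z^d A(z) dz / (2 pi i) *)
Definition oint (d : int) (A : int -> pser) : pser := A (- 1 - d).

Section Waves.
Variable tau : int -> F.

Definition psi1 (n : int) : int -> F :=
  zdown n (fun j => shift (- 1) c1 (tau n) j / tau n).
Definition psi2 (n : int) : int -> F :=
  zup n (fun j => shift (- 1) c2 (tau (n + 1)) j / tau n).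
Definition psi1s (n : int) : int -> F :=
  zdown (- n + 1) (fun j => shift 1 c1 (tau n) j / tau n).
Definition psi2s (n : int) : int -> F :=
  zup (- n + 1) (fun j => shift 1 c2 (tau (n - 1)) j / tau n).

End Waves.

(* iota_Lambda (Lambda - 1)^-1 and iota_{Lambda^-1} (Lambda - 1)^-1 acting on
   the variable n of a family of waves which all have the same exponential *)
Definition iotaL (f : int -> int -> F) : int -> int -> F := fun n k =>
  - \sum_(i \in [set: nat]) f (n + i%:Z) k.
Definition iotaLV (f : int -> int -> F) : int -> int -> F := fun n k =>
  \sum_(i \in [set: nat]) f (n - i.+1%:Z) k.

(** ** Shift operators: [A j n] is the coefficient a_j(n) of Lambda^j *)

Definition op := int -> int -> F.

Definition omul (A B : op) : op := fun j n =>
  \sum_(i \in [set: int]) A i n * B (j - i) (n + i).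
Definition oLam (k : int) : op := fun j _ => (j == k)%:R.
Definition omulf (f : int -> F) : op := fun j n => if j == 0 then f n else 0.
Definition oexp (A : op) (p : nat) : op := iter p (omul A) (oLam 0).
Definition ocomm (A B : op) : op := fun j n => omul A B j n - omul B A j n.
Definition ogeq0 (A : op) : op := fun j n => if 0 <= j then A j n else 0.
Definition olt0 (A : op) : op := fun j n => if j < 0 then A j n else 0.
Definition oadj (A : op) : op := fun j n => A (- j) (n + j).
Definition oact (A : op) (f : int -> F) : int -> F := fun n =>
  \sum_(i \in [set: int]) A i n * f (n + i).
(* the operator A(n - 1) *)
Definition opred (A : op) : op := fun j n => A j (n - 1).
Definition oder (i : tvar) (A : op) : op := fun j n => D i (A j n).
(* A(z^n), as a Laurent series in z. As exp(xi(t, Lambda)) (z^n) is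
   z^n exp(xi(t, z)), the amplitude of (A exp(xi(t, Lambda))) (z^n) is A(z^n);
   likewise with Lambda^-1 and z^-1. *)
Definition ozpow (A : op) (n : int) : int -> F := fun k => A (k - n) n.

Definition S1op (omega : nat -> int -> F) : op := fun j n =>
  if j == 0 then 1 else if j < 0 then omega `|j|%N n else 0.
Definition S2op (nu : nat -> int -> F) : op := fun j n =>
  if 0 <= j then nu `|j|%N n else 0.

(* the two-sided inverse of S among the operators satisfying P *)
Definition oinv (P : set op) (S : op) : op :=
  xget (oLam 0)
    [set T | [/\ P T, omul S T = oLam 0 & omul T S = oLam 0]].
Definition nonpos_order : set op := [set T | forall j n, 0 < j -> T j n = 0].
Definition nonneg_order : set op := [set T | forall j n, j < 0 -> T j n = 0].

Definition Lax1 (S1 : op) : op :=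
  omul (omul S1 (oLam 1)) (oinv nonpos_order S1).
Definition Lax2 (S2 : op) : op :=
  omul (omul S2 (oLam (- 1))) (oinv nonneg_order S2).

End Formal.

(* Main.v *)
Require Import Defs.
From HB Require Import structures.
From mathcomp Require Import all_boot all_order all_algebra.
From mathcomp Require Import finmap multiset.
From mathcomp Require Import boolp classical_sets cardinality fsbigop.
From mathcomp Require Import zify ring.

Set Implicit Arguments.
Unset Strict Implicit.
Unset Printing Implicit Defensive.

Import Order.TTheory GRing.Theory Num.Theory.
Local Open Scope classical_set_scope.
Local Open Scope ring_scope.

(* Write <u, v> for the pairing Res z^-1 u1 v1 - Res z^-1 u2 v2 of a pair u of
   waves with a pair v of dual waves. Applying Lambda - 1 in n'' to the equation
   for q gives q_n'' <psi(n', t'), psi^*(n'' + 1, t'')> = 0, hence the bilinear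
   equation of the 2-Toda hierarchy, but only at those n'' where q_n'' <> 0;
   likewise for r. One nonzero value is enough: the t''-derivatives of the
   corresponding dual wave yield annihilators of all psi(n', t') in every degree,
   which forces d psi(n) = c psi(n + 1) + b psi(n) for t^(1)_1, and
   d psi(n) = c psi(n - 1) + b psi(n) for t^(2)_1, with c invertible. As q_n is
   the pairing of psi(n) with something independent of n, it satisfies the same
   relations, and so vanishes nowhere. Hence the bilinear equation holds for all
   n''. Its order 0 in t' - t'' says that psi^* encodes S_a^-1, its order 1 is
   the Sato equation, and the rest is dressing. *)

(** * Finitely supported sums and shift operators *)

(** The invertibility of c comes from leading terms. A wave of index n has leading degree n in both
    components, the highest degree in psi_1 and the lowest in psi_2, with an invertible coefficient.
    Its pairing with an annihilator of leading degree -n therefore reduces, in each component, to a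
    product of two leading coefficients, and the equality of the two products carries invertibility
    from one component to the other. The times t^(1)_1 and t^(2)_1 serve for this because they move
    the leading degree by exactly one, up and down. The assumption that some tau_{1,n} or tau_{-1,n}
    is nonzero supplies the starting value: with all q and r zero, their equations would read 0 = 0
    and put no condition on psi^*. Operators bounded on opposite sides cannot be multiplied freely,
    so S_1 and S_2 never meet in a product. They are linked only by equalities such as S_1 T_1 = S_2
    T_2, whose two sides are bounded on opposite sides and hence finite. *)

Section FiniteSums.
Variables (F : idomainType).
Implicit Types I J : choiceType.

Definition fin_supp I (f : I -> F) : Prop :=
  exists A : {fset I}, forall i, i \notin A -> f i = 0.

Lemma fin_suppP (f : int -> F) (lo hi : int) :
  (forall i, i < lo -> f i = 0) -> (forall i, hi < i -> f i = 0) -> fin_supp f.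
Proof.
move=> flo fhi.
pose s := [seq lo + k%:Z | k <- iota 0 `|hi - lo|.+1].
exists (seq_fset tt s) => i; rewrite seq_fsetE => /negP iN.
have [/flo//|ilo] := ltP i lo; have [/fhi//|ihi] := ltP hi i.
by case: iN; apply/mapP; exists `|i - lo|%N; rewrite ?mem_iota; lia.
Qed.

Lemma fsumE I (f : I -> F) (A : {fset I}) :
  (forall i, i \notin A -> f i = 0) ->
  \sum_(i \in [set: I]) f i = \sum_(i <- A) f i.
Proof. exact: fsbigTE. Qed.

Lemma fsum0 I (f : I -> F) :
  (forall i, f i = 0) -> \sum_(i \in [set: I]) f i = 0.
Proof. by move=> f0; apply: fsbig1. Qed.

Lemma eq_fsum I (f g : I -> F) :
  f =1 g -> \sum_(i \in [set: I]) f i = \sum_(i \in [set: I]) g i.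
Proof. by move=> fg; apply: eq_fsbigr => i _. Qed.

Lemma fsum1 I (f : I -> F) i0 :
  (forall i, i != i0 -> f i = 0) -> \sum_(i \in [set: I]) f i = f i0.
Proof.
move=> f0; rewrite (@fsumE _ _ [fset i0]%fset) ?big_seq_fset1// => i.
by rewrite inE; apply: f0.
Qed.

Lemma fsumD I (f g : I -> F) : fin_supp f -> fin_supp g ->
  \sum_(i \in [set: I]) (f i + g i) =
  \sum_(i \in [set: I]) f i + \sum_(i \in [set: I]) g i.
Proof.
move=> [A fA] [B gB].
have fAB i : i \notin (A `|` B)%fset -> f i = 0.
  by rewrite inE negb_or => /andP[/fA].
have gAB i : i \notin (A `|` B)%fset -> g i = 0.
  by rewrite inE negb_or => /andP[_ /gB].
rewrite (fsumE fAB) (fsumE gAB) (@fsumE _ _ (A `|` B)%fset) ?big_split// => i iN.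
by rewrite fAB// gAB// addr0.
Qed.

Lemma fsum_morph I (d : F -> F) (f : I -> F) :
  (forall x y, d (x + y) = d x + d y) -> fin_supp f ->
  d (\sum_(i \in [set: I]) f i) = \sum_(i \in [set: I]) d (f i).
Proof.
move=> dD [A fA].
have d0 : d 0 = 0 by apply: (addIr (d 0)); rewrite -dD !add0r.
rewrite (fsumE fA) (@fsumE _ _ A) => [|i /fA->//].
by apply: (big_morph d).
Qed.

Lemma exchange_fsum I J (f : I -> J -> F) (A : {fset I}) (B : {fset J}) :
  (forall i j, i \notin A -> f i j = 0) -> (forall i j, j \notin B -> f i j = 0) ->
  \sum_(i \in [set: I]) \sum_(j \in [set: J]) f i j =
  \sum_(j \in [set: J]) \sum_(i \in [set: I]) f i j.
Proof.
move=> fA fB.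
rewrite (@fsumE _ _ A) => [|i iA]; last by apply: fsum0 => j; apply: fA.
rewrite [RHS](@fsumE _ _ B) => [|j jB]; last by apply: fsum0 => i; apply: fB.
under eq_bigr => i _ do rewrite (fsumE (fB i)).
rewrite exchange_big; apply: eq_bigr => j _.
by rewrite (@fsumE _ _ A)// => i iA; apply: fA.
Qed.

Lemma exchange_fsum_int (f : int -> int -> F) (lo hi lo' hi' : int) :
  (forall i j, f i j != 0 -> lo <= i <= hi /\ lo' <= j <= hi') ->
  \sum_(i \in [set: int]) \sum_(j \in [set: int]) f i j =
  \sum_(j \in [set: int]) \sum_(i \in [set: int]) f i j.
Proof.
move=> fb.
pose s (a b : int) := [seq a + k%:Z | k <- iota 0 `|b - a|.+1].
pose itv (a b : int) := seq_fset tt (s a b).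
have itvP a b i : a <= i <= b -> i \in itv a b.
  move=> iab; rewrite seq_fsetE; apply/mapP.
  by exists `|i - a|%N; rewrite ?mem_iota; lia.
apply: (@exchange_fsum _ _ _ (itv lo hi) (itv lo' hi')) => i j.
  by apply: contraNeq => /fb[/itvP].
by apply: contraNeq => /fb[_ /itvP].
Qed.

Lemma reindex_fsum (f : int -> F) (h g : int -> int) :
  cancel h g -> cancel g h ->
  \sum_(i \in [set: int]) f i = \sum_(i \in [set: int]) f (h i).
Proof. by move=> hK gK; apply: reindex_fsbigT; exists g. Qed.

End FiniteSums.

(** Orientation of component [a]: series are bounded above for [c1] and below for [c2], so
    [0 < sg a * (k - d)] says that k lies beyond the bound d. It is also the exponent of the shift
    dressed into L_a. *)
Definition sg (a : bool) : int := if a then -1 else 1.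

Section Operators.
Variables (F : idomainType).
Implicit Types (A B C : op F) (a : bool) (d e : int).

(** For a fixed [a] these operators are closed under products, which are then finite sums;
    associativity and distributivity are proved inside one such class only. *)
Definition ordle a d A : Prop := forall j n, 0 < sg a * (j - d) -> A j n = 0.
Definition oadd A B : op F := fun j n => A j n + B j n.

Lemma omul_supp a d e A B j n : ordle a d A -> ordle a e B ->
  fin_supp (fun i => A i n * B (j - i) (n + i)).
Proof.
move=> Ad Be; apply: (@fin_suppP _ _ (- (`|d| + `|j| + `|e|)%:Z) (`|d| + `|j| + `|e|)%:Z).
  move=> i ilt; case: a Ad Be => Ad Be; [rewrite Ad ?mul0r//|rewrite Be ?mulr0//];
  rewrite /sg; lia.
move=> i ilt; case: a Ad Be => Ad Be; [rewrite Be ?mulr0//|rewrite Ad ?mul0r//];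
  rewrite /sg; lia.
Qed.

Lemma ordleW a d e A : 0 <= sg a * (e - d) -> ordle a d A -> ordle a e A.
Proof. by move=> de Ad j n je; apply: Ad; case: a de je; rewrite /sg; lia. Qed.

Lemma ordle_mul a d e A B :
  ordle a d A -> ordle a e B -> ordle a (d + e) (omul A B).
Proof.
move=> Ad Be j n jde; apply: fsum0 => i.
have [ia|ia] := ltP 0 (sg a * (i - d)); first by rewrite Ad ?mul0r.
by rewrite Be ?mulr0//; case: a ia jde {Ad Be}; rewrite /sg; lia.
Qed.

Lemma ordle_add a d A B : ordle a d A -> ordle a d B -> ordle a d (oadd A B).
Proof. by move=> Ad Bd j n jd; rewrite /oadd Ad// Bd// addr0. Qed.

Lemma ordle_Lam a d : ordle a d (oLam F d).
Proof.
move=> j n jd; rewrite /oLam; case: eqP => // jdE.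
by move: jd; rewrite jdE; case: a; rewrite /sg; lia.
Qed.

Lemma ordle0 a d : ordle a d (fun _ _ => 0).
Proof. by []. Qed.

Lemma omulA a d e f A B C : ordle a d A -> ordle a e B -> ordle a f C ->
  omul A (omul B C) = omul (omul A B) C.
Proof.
move=> Ad Be Cf; apply/funext => j; apply/funext => n; rewrite /omul.
transitivity (\sum_(i \in [set: int]) \sum_(k \in [set: int])
    A i n * B (k - i) (n + i) * C (j - k) (n + k)).
  apply: eq_fsum => i; rewrite mulr_fsumr.
  rewrite (@reindex_fsum _ _ (fun k => k - i) (fun k => k + i)); last 2 first.
  - by move=> k; lia.
  - by move=> k; lia.
  apply: eq_fsum => k; rewrite mulrA.
  by have [-> ->] : j - i - (k - i) = j - k /\ n + i + (k - i) = n + k by lia.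
(* In a nonzero term i, k - i and j - k are bounded on the same side by d, e and f. As they add up
   to j, each is bounded on the other side too. *)
pose K : int := (`|d| + `|j| + `|e| + `|f|)%:Z.
rewrite (@exchange_fsum_int _ _ (- K) K (- K) K); last first.
  move=> i k; rewrite !mulf_eq0 !negb_or -andbA => /and3P[iA kB jC].
  have : sg a * (i - d) <= 0.
    by rewrite leNgt; apply: contraNN iA => /Ad->.
  have : sg a * (k - i - e) <= 0.
    by rewrite leNgt; apply: contraNN kB => /Be->.
  have : sg a * (j - k - f) <= 0.
    by rewrite leNgt; apply: contraNN jC => /Cf->.
  by rewrite /K; case: (a); rewrite /sg; lia.
by apply: eq_fsum => k; rewrite mulr_fsuml.
Qed.

Lemma omulDl a d e A B C : ordle a d A -> ordle a d B -> ordle a e C ->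
  omul (oadd A B) C = oadd (omul A C) (omul B C).
Proof.
move=> Ad Bd Ce; apply/funext => j; apply/funext => n; rewrite /omul /oadd.
rewrite -fsumD; try by apply: omul_supp; eauto.
by apply: eq_fsum => i; rewrite mulrDl.
Qed.

Lemma omulDr a d e A B C : ordle a d A -> ordle a e B -> ordle a e C ->
  omul A (oadd B C) = oadd (omul A B) (omul A C).
Proof.
move=> Ad Be Ce; apply/funext => j; apply/funext => n; rewrite /omul /oadd.
rewrite -fsumD; try by apply: omul_supp; eauto.
by apply: eq_fsum => i; rewrite mulrDr.
Qed.

Lemma oLam_mulE d A j n : omul (oLam F d) A j n = A (j - d) (n + d).
Proof.
rewrite /omul (@fsum1 _ _ _ d) => [|i id]; first by rewrite /oLam eqxx mul1r.
by rewrite /oLam (negPf id) mul0r.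
Qed.

Lemma omul_LamE d A j n : omul A (oLam F d) j n = A (j - d) n.
Proof.
rewrite /omul (@fsum1 _ _ _ (j - d)) => [|i id]; rewrite /oLam.
  by rewrite (_ : j - (j - d) = d) ?eqxx ?mulr1//; lia.
by rewrite (_ : (j - i == d) = false) ?mulr0//; apply/negbTE; move: id; lia.
Qed.

Lemma omul1l A : omul (oLam F 0) A = A.
Proof. by apply/funext => j; apply/funext => n; rewrite oLam_mulE subr0 addr0. Qed.

Lemma omul1r A : omul A (oLam F 0) = A.
Proof. by apply/funext => j; apply/funext => n; rewrite omul_LamE subr0. Qed.

Lemma omul0l A : omul (fun _ _ => 0) A = (fun _ _ => 0).
Proof. by apply/funext => j; apply/funext => n; apply: fsum0 => i; rewrite mul0r. Qed.

Lemma omul0r A : omul A (fun _ _ => 0) = (fun _ _ => 0).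
Proof. by apply/funext => j; apply/funext => n; apply: fsum0 => i; rewrite mulr0. Qed.

Lemma oLamD d e : omul (oLam F d) (oLam F e) = oLam F (d + e).
Proof.
apply/funext => j; apply/funext => n; rewrite oLam_mulE /oLam.
by congr (_%:R); rewrite subr_eq addrC.
Qed.

Lemma omul_lead a d e A B n : ordle a d A -> ordle a e B ->
  omul A B (d + e) n = A d n * B e (n + d).
Proof.
move=> Ad Be; rewrite /omul (@fsum1 _ _ _ d) => [|i id].
  by rewrite (_ : d + e - d = e)//; lia.
have [ia|ia] := ltP 0 (sg a * (i - d)); first by rewrite Ad ?mul0r.
by rewrite Be ?mulr0//; case: a ia id {Ad Be}; rewrite /sg; lia.
Qed.

(** Leading coefficients multiply, so in a domain the leading coefficient of Y vanishes, and the
    order of Y can be lowered forever. *)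
Lemma omul_lreg a d A Y : ordle a 0 A -> (forall n, A 0 n != 0) -> ordle a d Y ->
  omul A Y = (fun _ _ => 0) -> Y = (fun _ _ => 0).
Proof.
move=> A0 Au Yd AY.
have Yk k : ordle a (d - sg a * k%:Z) Y.
  elim: k => [|k IH]; first by rewrite mulr0 subr0.
  move=> j n jk; have [->|jd] := eqVneq j (d - sg a * k%:Z); last first.
    by apply: IH; move: jk jd; case: (a); rewrite /sg; lia.
  have := omul_lead n A0 IH; rewrite AY addr0 => /esym/eqP.
  by rewrite mulf_eq0 (negPf (Au n)) => /eqP.
apply/funext => j; apply/funext => n; apply: (Yk (`|d| + `|j|).+1).
by case: (a); rewrite /sg; lia.
Qed.

(** S (T S - 1) = (S T - 1) S = 0, and S can be cancelled on the left. *)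
Lemma omul_inv_sym a S T : ordle a 0 S -> ordle a 0 T ->
  (forall n, S 0 n != 0) -> omul S T = oLam F 0 -> omul T S = oLam F 0.
Proof.
move=> S0 T0 Su ST.
pose N : op F := fun j n => - oLam F 0 j n.
have NE B : omul B N = fun j n => - B j n.
  apply/funext => j; apply/funext => n; rewrite -[in RHS](omul1r B) /omul.
  by rewrite -mulN1r mulr_fsumr; apply: eq_fsum => i; rewrite /N mulN1r mulrN.
have N0 : ordle a 0 N by move=> j n jd; rewrite /N (ordle_Lam n jd) oppr0.
have T0S : ordle a 0 (omul T S) by rewrite -(addr0 0); apply: ordle_mul.
suff : oadd (omul T S) N = fun _ _ => 0.
  move=> E; apply/funext => j; apply/funext => n.
  by have /(congr1 (fun f => f j n)) := E; rewrite /oadd /N => /eqP; rewrite subr_eq0 => /eqP.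
apply: (omul_lreg S0 Su (ordle_add T0S N0)).
rewrite (omulDr S0 T0S N0) (omulA S0 T0 S0) ST omul1l NE.
by apply/funext => j; apply/funext => n; rewrite /oadd subrr.
Qed.

(** A two-sided inverse is unique within a class where products associate, so the choice made by
    [xget] is forced. *)
Lemma oinvP a (P : set (op F)) S T :
  (forall A, P A -> ordle a 0 A) -> P T -> ordle a 0 S ->
  omul S T = oLam F 0 -> omul T S = oLam F 0 -> oinv P S = T.
Proof.
move=> Pa PT S0 ST TS; apply: xget_unique => [//|T' [PT' ST' T'S]].
by rewrite -[T']omul1r -ST (omulA (Pa _ PT') S0 (Pa _ PT)) T'S omul1l.
Qed.

Lemma oexp_conj a d S T p : ordle a 0 S -> ordle a 0 T ->
  omul S T = oLam F 0 -> omul T S = oLam F 0 ->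
  oexp (omul (omul S (oLam F d)) T) p = omul (omul S (oLam F (d * p%:Z))) T.
Proof.
move=> S0 T0 ST TS; elim: p => [|p IH]; first by rewrite mulr0 omul1r ST.
have L e := @ordle_Lam a e; have SL e := ordle_mul S0 (L e).
rewrite /oexp iterS -/(oexp _ p) IH.
rewrite -(omulA (SL _) T0 (ordle_mul (SL _) T0)).
rewrite (omulA T0 (SL _) T0) (omulA T0 S0 (L _)) TS omul1l.
rewrite (omulA (SL _) (L _) T0) -(omulA S0 (L _) (L _)) oLamD.
by congr (omul (omul _ (oLam F _)) _); lia.
Qed.

End Operators.

(** * Dressing and Lax equations *)

Section Derivations.
Variables (F : idomainType) (D : tvar -> F -> F).
Hypothesis derD : forall v : tvar, is_derivation (D v).

Lemma tderD v : {morph D v : f g / f + g}.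
Proof. by move=> f g; case: (derD v). Qed.

Lemma tderM v f g : D v (f * g) = D v f * g + f * D v g.
Proof. by case: (derD v). Qed.

Lemma tder0 v : D v 0 = 0.
Proof. by apply: (addIr (D v 0)); rewrite -tderD !add0r. Qed.

Lemma tder1 v : D v 1 = 0.
Proof. by apply: (addIr (D v 1)); rewrite add0r -{3}[1]mulr1 tderM mulr1 mul1r. Qed.

Lemma ordle_der a d v A : ordle a d A -> ordle a d (oder D v A).
Proof. by move=> Ad j n jd; rewrite /oder Ad// tder0. Qed.

Lemma oder_mul a d e v A B : ordle a d A -> ordle a e B ->
  oder D v (omul A B) = oadd (omul (oder D v A) B) (omul A (oder D v B)).
Proof.
move=> Ad Be; apply/funext => j; apply/funext => n; rewrite /oadd /omul /oder.
rewrite fsum_morph; last 2 first.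
- exact: tderD.
- exact: omul_supp Ad Be.
rewrite -fsumD.
- by apply: eq_fsum => i; rewrite tderM.
- exact: omul_supp (ordle_der v Ad) Be.
- exact: omul_supp Ad (ordle_der v Be).
Qed.

Lemma oder_Lam v d : oder D v (oLam F d) = fun _ _ => 0.
Proof.
apply/funext => j; apply/funext => n; rewrite /oder /oLam.
by case: eqP => _; rewrite ?tder1 ?tder0.
Qed.

Variables S T : bool -> op F.
Hypothesis S_ord : forall a, ordle a 0 (S a).
Hypothesis T_ord : forall a, ordle a 0 (T a).
Hypothesis S1_lead : forall n, S c1 0 n = 1.
Hypothesis ST : forall a, omul (S a) (T a) = oLam F 0.
Hypothesis TS : forall a, omul (T a) (S a) = oLam F 0.

(** The operator by which D v multiplies exp(xi(t^(a), Lambda^(+-1))); it is zero when v is a time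
    of the other exponential. *)
Definition flow_sym (v : tvar) (a : bool) : op F :=
  if v.1 == a then oLam F (sg a * v.2.+1%:Z) else fun _ _ => 0.
Definition sato_lhs (v : tvar) (a : bool) : op F :=
  oadd (oder D v (S a)) (omul (S a) (flow_sym v a)).
(** The operator B with D v Psi_a = B Psi_a, where Psi_a is S_a times its exponential. That both
    components give the same B is [flow_op_eq], the order 1 of the bilinear equation. *)
Definition flow_op (v : tvar) : op F := omul (sato_lhs v c1) (T c1).
Definition lax (a : bool) : op F := omul (omul (S a) (oLam F (sg a))) (T a).

Hypothesis flow_op_eq : forall v, omul (sato_lhs v c2) (T c2) = flow_op v.

Let flow_opE v a : flow_op v = omul (sato_lhs v a) (T a).
Proof. by case: a; rewrite // -flow_op_eq. Qed.

Lemma ordle_flow_sym v a : ordle a (sg a * v.2.+1%:Z) (flow_sym v a).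
Proof. by rewrite /flow_sym; case: eqP => _; [apply: ordle_Lam|apply: ordle0]. Qed.

Lemma ordle_sato v a : ordle a (sg a * v.2.+1%:Z) (sato_lhs v a).
Proof.
apply: ordle_add.
  by apply: (ordleW _ (ordle_der v (@S_ord a))); case: (a); rewrite /sg; lia.
by rewrite -[X in ordle a X _]add0r; apply: ordle_mul (@S_ord a) (@ordle_flow_sym v a).
Qed.

Lemma ordle_flow_op v a : ordle a (sg a * v.2.+1%:Z) (flow_op v).
Proof.
by rewrite (flow_opE v a) -[X in ordle a X _]addr0; apply: ordle_mul (@ordle_sato v a) (@T_ord a).
Qed.

Lemma ordle_lax a : ordle a (sg a) (lax a).
Proof.
rewrite -[sg a]addr0 -{1}[sg a]add0r; apply: ordle_mul => //.
by apply: ordle_mul => //; apply: ordle_Lam.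
Qed.

Lemma sato v a : sato_lhs v a = omul (flow_op v) (S a).
Proof.
by rewrite (flow_opE v a) -(omulA (@ordle_sato v a) (@T_ord a) (@S_ord a)) TS omul1r.
Qed.

Lemma lax_dressing a : omul (lax a) (S a) = omul (S a) (oLam F (sg a)).
Proof.
rewrite /lax -(omulA (ordle_mul (@S_ord a) (@ordle_Lam F a (sg a))) (@T_ord a) (@S_ord a)).
by rewrite TS omul1r.
Qed.

Lemma oaddA (A B C : op F) : oadd A (oadd B C) = oadd (oadd A B) C.
Proof. by apply/funext => j; apply/funext => n; rewrite /oadd addrA. Qed.

Lemma oaddC (A B : op F) : oadd A B = oadd B A.
Proof. by apply/funext => j; apply/funext => n; rewrite /oadd addrC. Qed.

Lemma oadd0 (A : op F) : oadd A (fun _ _ => 0) = A.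
Proof. by apply/funext => j; apply/funext => n; rewrite /oadd addr0. Qed.

(** Differentiate L S = S Lambda^(+-1) and replace the derivative of S by B S - S C, where the
    symbol C commutes with Lambda^(+-1). The comparison is made after multiplication by S on the
    right, which T undoes. *)
Lemma lax_eq v a :
  oadd (oder D v (lax a)) (omul (lax a) (flow_op v)) = omul (flow_op v) (lax a).
Proof.
have So := @S_ord a; have To := @T_ord a; have Lo := @ordle_lax a.
have Bo := @ordle_flow_op v a; have Co := @ordle_flow_sym v a.
have dSo := ordle_der v So; have dLo := ordle_der v Lo.
have Ao := @ordle_Lam F a (sg a).
have LBo := ordle_mul Lo Bo; have BLo := ordle_mul Bo Lo.
have dLo' : ordle a (sg a + sg a * v.2.+1%:Z) (oder D v (lax a)).
  by apply: (ordleW _ dLo); case: (a); rewrite /sg; lia.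
have dSo' : ordle a (sg a * v.2.+1%:Z) (oder D v (S a)).
  by apply: (ordleW _ dSo); case: (a); rewrite /sg; lia.
have Sum := ordle_add dLo' LBo.
have SCo : ordle a (sg a * v.2.+1%:Z) (omul (S a) (flow_sym v a)).
  by rewrite -[X in ordle a X _]add0r; apply: ordle_mul.
have comm : omul (flow_sym v a) (oLam F (sg a)) = omul (oLam F (sg a)) (flow_sym v a).
  by rewrite /flow_sym; case: eqP => _; rewrite ?omul0l ?omul0r// !oLamD addrC.
suff E : omul (oadd (oder D v (lax a)) (omul (lax a) (flow_op v))) (S a) =
         omul (omul (flow_op v) (lax a)) (S a).
  rewrite -[LHS]omul1r -[RHS]omul1r -(ST a) (omulA Sum So To) E.
  by rewrite -(omulA BLo So To).
rewrite (omulDl dLo' LBo So) -(omulA Lo Bo So) -(omulA Bo Lo So) lax_dressing -sato.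
rewrite (omulA Bo So Ao) -sato (omulDr Lo dSo' SCo) oaddA -(oder_mul v Lo So).
rewrite lax_dressing (oder_mul v So Ao) oder_Lam omul0r oadd0 (omulDl dSo' SCo Ao).
by rewrite (omulA Lo So Co) lax_dressing -(omulA So Ao Co) -comm (omulA So Co Ao).
Qed.

(** The Sato equation for the inverse: multiplied by S on the left, it follows from the vanishing of
    the derivative of S T. *)
Lemma dual_sato v a :
  oadd (oder D v (T a)) (omul (T a) (flow_op v)) = omul (flow_sym v a) (T a).
Proof.
have So := @S_ord a; have To := @T_ord a.
have Bo := @ordle_flow_op v a; have Co := @ordle_flow_sym v a.
have dSo := ordle_der v So; have dTo := ordle_der v To.
have dSo' : ordle a (sg a * v.2.+1%:Z) (oder D v (S a)).
  by apply: (ordleW _ dSo); case: (a); rewrite /sg; lia.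
have dTo' : ordle a (0 + sg a * v.2.+1%:Z) (oder D v (T a)).
  by apply: (ordleW _ dTo); case: (a); rewrite /sg; lia.
have SCo : ordle a (sg a * v.2.+1%:Z) (omul (S a) (flow_sym v a)).
  by rewrite -[X in ordle a X _]add0r; apply: ordle_mul.
have TBo := ordle_mul To Bo; have CTo := ordle_mul Co To.
suff E : omul (S a) (oadd (oder D v (T a)) (omul (T a) (flow_op v))) =
         omul (S a) (omul (flow_sym v a) (T a)).
  rewrite -[LHS]omul1l -[RHS]omul1l -(TS a) -(omulA To So (ordle_add dTo' TBo)) E.
  by rewrite (omulA To So CTo).
rewrite (omulDr So dTo' TBo) (omulA So To Bo) ST omul1l (flow_opE v a).
rewrite (omulDl dSo' SCo To) oaddA [X in oadd X _]oaddC -(oder_mul v So To).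
by rewrite ST oder_Lam oaddC oadd0 (omulA So Co To).
Qed.

(** In the first component B is a power of L_1 plus D(S_1) T_1, which has negative order because the
    leading coefficient of S_1 is the constant 1. In the second component the symbol is zero, so B =
    D(S_2) T_2 has no negative powers. *)
Lemma flow_op1 p : flow_op (c1, p) = ogeq0 (oexp (lax c1) p.+1).
Proof.
have So := @S_ord; have To := @T_ord.
apply/funext => j; apply/funext => n; rewrite /ogeq0; case: leP => j0.
  rewrite /flow_op (omulDl (d := sg c1 * p.+1%:Z) _ _ (To c1)); first last.
  - rewrite -[X in ordle _ X _]add0r; apply: ordle_mul (So c1) (@ordle_flow_sym (c1, p) c1).
  - by apply: (ordleW _ (ordle_der _ (So c1))); rewrite /sg/=; lia.
  rewrite /lax (oexp_conj _ _ (So c1) (To c1) (ST c1) (TS c1)) /oadd /flow_sym eqxx/= addrC.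
  have dS : ordle c1 (-1) (oder D (c1, p) (S c1)).
    move=> i k ik; rewrite /oder; have [->|i0] := eqVneq i 0.
      by rewrite S1_lead tder1.
    by rewrite So ?tder0//; move: ik i0; rewrite /sg /=; lia.
  by rewrite (ordle_mul dS (To c1)) ?addr0//; rewrite /sg/=; lia.
rewrite (flow_opE _ c2) /sato_lhs /flow_sym/= omul0r oadd0.
by rewrite (ordle_mul (ordle_der _ (So c2)) (To c2))// /sg/=; lia.
Qed.

(** The roles are exchanged, but the leading coefficient of S_2 depends on t: D(S_2) T_2 may have
    order 0, and the truncation is therefore strict. *)
Lemma flow_op2 p : flow_op (c2, p) = olt0 (oexp (lax c2) p.+1).
Proof.
have So := @S_ord; have To := @T_ord.
apply/funext => j; apply/funext => n; rewrite /olt0; case: ltP => j0.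
  rewrite (flow_opE _ c2) (omulDl (d := sg c2 * p.+1%:Z) _ _ (To c2)); first last.
  - rewrite -[X in ordle _ X _]add0r; apply: ordle_mul (So c2) (@ordle_flow_sym (c2, p) c2).
  - by apply: (ordleW _ (ordle_der _ (So c2))); rewrite /sg/=; lia.
  rewrite /lax (oexp_conj _ _ (So c2) (To c2) (ST c2) (TS c2)) /oadd /flow_sym eqxx/= addrC.
  by rewrite (ordle_mul (ordle_der _ (So c2)) (To c2)) ?addr0//; rewrite /sg/=; lia.
rewrite (flow_opE _ c1) /sato_lhs /flow_sym/= omul0r oadd0.
have dS : ordle c1 (-1) (oder D (c2, p) (S c1)).
  move=> i k ik; rewrite /oder; have [->|i0] := eqVneq i 0.
    by rewrite S1_lead tder1.
  by rewrite So ?tder0//; move: ik i0; rewrite /sg /=; lia.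
by rewrite (ordle_mul dS (To c1))// /sg/=; lia.
Qed.

End Derivations.

(** * Residue pairings and annihilators *)

Section Residues.
Variables (F : idomainType).
Implicit Types (u v x y : int -> F) (a : bool) (d e k : int).

Definition ampl_le a d u : Prop := forall k, 0 < sg a * (k - d) -> u k = 0.
(** The coefficient of z^k in u v; the pairing Res z^-1 u v is [res u v 0]. *)
Definition res u v k : F := \sum_(i \in [set: int]) u i * v (k - i).

Lemma ampl_leW a d e u : 0 <= sg a * (e - d) -> ampl_le a d u -> ampl_le a e u.
Proof. by move=> de ud k ke; apply: ud; case: a de ke; rewrite /sg; lia. Qed.

Lemma ampl_leZ a d c u : ampl_le a d u -> ampl_le a d (fun k => c * u k).
Proof. by move=> ud k kd; rewrite ud ?mulr0. Qed.

Lemma res_supp a d e u v k : ampl_le a d u -> ampl_le a e v ->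
  fin_supp (fun i => u i * v (k - i)).
Proof.
move=> ud ve.
apply: (@fin_suppP _ _ (- (`|d| + `|k| + `|e|)%:Z) (`|d| + `|k| + `|e|)%:Z) => i ilt;
  case: a ud ve => ud ve.
- by rewrite ud ?mul0r// /sg; lia.
- by rewrite ve ?mulr0// /sg; lia.
- by rewrite ve ?mulr0// /sg; lia.
- by rewrite ud ?mul0r// /sg; lia.
Qed.

Lemma resC u v k : res u v k = res v u k.
Proof.
rewrite /res (@reindex_fsum _ _ (fun i => k - i) (fun i => k - i)).
- by apply: eq_fsum => i; rewrite mulrC subKr.
- by move=> i; rewrite subKr.
- by move=> i; rewrite subKr.
Qed.

Lemma resZl c u v k : res (fun i => c * u i) v k = c * res u v k.
Proof. by rewrite /res mulr_fsumr; apply: eq_fsum => i; rewrite mulrA. Qed.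

Lemma resZr c u v k : res u (fun i => c * v i) k = c * res u v k.
Proof. by rewrite resC resZl resC. Qed.

Lemma resDl a d e f u u' v k :
  ampl_le a d u -> ampl_le a e u' -> ampl_le a f v ->
  res (fun i => u i + u' i) v k = res u v k + res u' v k.
Proof.
move=> ud ue vf; rewrite /res -fsumD.
- by apply: eq_fsum => i; rewrite mulrDl.
- exact: res_supp ud vf.
- exact: res_supp ue vf.
Qed.

Lemma resDr a d e f u v v' k :
  ampl_le a d u -> ampl_le a e v -> ampl_le a f v' ->
  res u (fun i => v i + v' i) k = res u v k + res u v' k.
Proof. by move=> ud ve vf; rewrite resC (resDl _ ve vf ud) resC (resC v'). Qed.

Lemma res_shift c u v k : res (fun i => u (i - c)) v k = res u v (k - c).
Proof.
rewrite /res (@reindex_fsum _ _ (fun i => i + c) (fun i => i - c)).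
- by apply: eq_fsum => i; rewrite addrK; congr (_ * v _); lia.
- by move=> i; rewrite addrK.
- by move=> i; rewrite subrK.
Qed.

Lemma res_lead a d u v k : ampl_le a d u -> ampl_le a (k - d) v ->
  res u v k = u d * v (k - d).
Proof.
move=> ud vd; rewrite /res (@fsum1 _ _ _ d) // => i id.
have [ia|ia] := ltP 0 (sg a * (i - d)); first by rewrite ud ?mul0r.
by rewrite vd ?mulr0//; case: a ia id {ud vd}; rewrite /sg; lia.
Qed.

Lemma res_eq0 a d e u v k : ampl_le a d u -> ampl_le a e v ->
  0 < sg a * (k - d - e) -> res u v k = 0.
Proof.
move=> ud ve de; apply: fsum0 => i.
have [ia|ia] := ltP 0 (sg a * (i - d)); first by rewrite ud ?mul0r.
by rewrite ve ?mulr0//; case: a ia de {ud ve}; rewrite /sg; lia.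
Qed.

End Residues.

(** * Annihilators of all waves and propagation of zeros *)

Section Annihilator.
Variables (F : idomainType) (D : tvar -> F -> F).
Hypothesis derD : forall v : tvar, is_derivation (D v).
Implicit Types (s : F) (v : tvar) (a b : bool) (u : int -> F).

(* The action of D v on waves, in terms of amplitudes: the exponential
   exp(s xi(t^(a), z^(+-1))) contributes s z^(+-j). *)
Definition nabla s v a u : int -> F := fun k =>
  D v (u k) + (if v.1 == a then s * u (k - sg a * v.2.+1%:Z) else 0).
Definition nablas s (l : seq tvar) a u : int -> F :=
  foldr (fun v => nabla s v a) u l.

Lemma nabla_le s v a d u :
  ampl_le a d u -> ampl_le a (d + sg a * v.2.+1%:Z) (nabla s v a u).
Proof.
move=> ud k kd; rewrite /nabla ud; last by move: kd; case: (a); rewrite /sg; lia.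
rewrite ud ?mulr0 ?if_same ?addr0; last by move: kd; case: (a); rewrite /sg; lia.
exact: tder0.
Qed.

Lemma nablas_le s l a d u :
  ampl_le a d u -> exists e, ampl_le a e (nablas s l a u).
Proof.
move=> ud; elim: l => [|v l [e IH]]; first by exists d.
by exists (e + sg a * v.2.+1%:Z); apply: nabla_le.
Qed.

Lemma deriv_le v a d u : ampl_le a d u -> ampl_le a d (fun k => D v (u k)).
Proof. by move=> ud k kd; rewrite ud// (tder0 derD). Qed.

(** The opposite exponentials of u and x contribute s and - s times the same shifted residue, and
    these cancel. *)
Lemma deriv_res s v a d e u x k : ampl_le a d u -> ampl_le a e x ->
  D v (res u x k) = res (nabla s v a u) x k + res u (nabla (- s) v a x) k.
Proof.
move=> ud xe.
have -> : D v (res u x k) = res (fun i => D v (u i)) x k + res u (fun i => D v (x i)) k.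
  rewrite /res fsum_morph; last 2 first.
  - exact: tderD.
  - exact: res_supp ud xe.
  rewrite -fsumD.
  - by apply: eq_fsum => i; rewrite (tderM derD).
  - exact: res_supp (deriv_le v ud) xe.
  - exact: res_supp ud (deriv_le v xe).
rewrite /nabla; case: eqP => _; last first.
  by congr (_ + _); apply: eq_fsum => i; rewrite addr0.
set c := sg a * _.
have sh (y : int -> F) f : ampl_le a f y -> ampl_le a (f + c) (fun k => y (k - c)).
  by move=> yf i ic; apply: yf; move: ic; case: (a); rewrite /sg; lia.
rewrite (resDl _ (deriv_le v ud) (ampl_leZ s (sh _ _ ud)) xe).
rewrite (resDr _ ud (deriv_le v xe) (ampl_leZ (- s) (sh _ _ xe))).
rewrite resZl resZr res_shift [res u (fun _ => x _) k]resC res_shift [res x u _]resC.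
by ring.
Qed.

Variables (s : F) (w : bool -> int -> int -> F).
Hypothesis s_unit : s \is a GRing.unit.
Hypothesis w_le : forall a n, ampl_le a n (w a n).
Hypothesis w_lead : forall a n, w a n n \is a GRing.unit.

(* A single bilinear equation, for a fixed dual wave x and all n', says that x
   lies in [annih]; by Leibniz, [annih] is stable under derivation in t''. *)
Definition annih (x : bool -> int -> F) : Prop := forall n l,
  res (nablas s l c1 (w c1 n)) (x c1) 0 = res (nablas s l c2 (w c2 n)) (x c2) 0.

(** The same e bounds the first component from above and the second from below, so one wave, that of
    index - e, meets both leading terms. *)
Definition level e (x : bool -> int -> F) : Prop :=
  (forall a, ampl_le a e (x a)) /\ (forall a, x a e \is a GRing.unit).

Lemma annih_nabla v e (x : bool -> int -> F) : level e x -> annih x ->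
  annih (fun a => nabla (- s) v a (x a)).
Proof.
move=> [xe _] xw n l.
have lei a (y : F) : y = res (nablas s l a (w a n)) (x a) 0 ->
    res (nablas s l a (w a n)) (nabla (- s) v a (x a)) 0 =
    D v y - res (nablas s (v :: l) a (w a n)) (x a) 0.
  move=> ->; have [d wd] := nablas_le s l (@w_le a n).
  by rewrite (deriv_res s v _ wd (xe a)) /= addrC addKr.
by rewrite (lei c1 _ erefl) (lei c2 _ (xw n l)) (xw n (v :: l)).
Qed.

(** Differentiation in t^(a)_1 moves the leading degree of component [a] by [sg a] through its
    exponential. The other component keeps its degree until a multiple of x removes its leading
    term. *)
Lemma level_step a e (x : bool -> int -> F) : level e x -> annih x ->
  exists x', level (e + sg a) x' /\ annih x'.
Proof.
move=> lx xw; have [xe xu] := lx.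
pose g := - (D (a, 0%N) (x (~~ a) e) / x (~~ a) e).
pose x' b k := nabla (- s) (a, 0%N) b (x b) k + g * x b k.
have x'w : annih x'.
  have ne b := @nabla_le (- s) (a, 0%N) b e (x b) (xe b).
  move=> n l; have := annih_nabla (a, 0%N) lx xw n l; have := xw n l.
  have [f1 wd1] := nablas_le s l (@w_le c1 n).
  have [f2 wd2] := nablas_le s l (@w_le c2 n).
  rewrite (resDr _ wd1 (ne c1) (ampl_leZ g (xe c1))).
  rewrite (resDr _ wd2 (ne c2) (ampl_leZ g (xe c2))).
  by rewrite !resZr => -> ->.
have x'le b : ampl_le b (e + sg a) (x' b).
  move=> k kd; rewrite /x'.
  have [ab|ab] := eqVneq b a.
    rewrite ab (@nabla_le _ _ _ e) ?xe ?mulr0 ?addr0//; move: kd; rewrite ab;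
    by case: (a); rewrite /sg /=; lia.
  have {}ab : b = ~~ a by move: ab; case: (a); case: (b).
  rewrite /nabla ab /=; have -> : (a == ~~ a) = false by case: (a).
  have [->|ke] := eqVneq k e; first by rewrite addr0 /g mulNr divrK ?subrr.
  rewrite xe ?(tder0 derD) ?mulr0 ?addr0//; move: kd ke; rewrite ab.
  by case: (a); rewrite /sg /=; lia.
have x'a : x' a (e + sg a) = - (s * x a e).
  rewrite /x' /nabla eqxx /= mulr1 addrK xe ?(tder0 derD) ?mulr0 ?addr0 ?add0r ?mulNr//.
  by case: (a); rewrite /sg; lia.
have x'au : x' a (e + sg a) \is a GRing.unit by rewrite x'a unitrN unitrM s_unit xu.
exists x'; split=> //; split=> // b.
(* Against the wave of index [- (e + sg a)] both residues are products of leading coefficients, so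
   the unit in component [a] forces one in component [~~ a]. *)
have := x'w (- (e + sg a)) [::]; rewrite /=.
have eN : 0 - - (e + sg a) = e + sg a by lia.
rewrite (@res_lead _ c1 (- (e + sg a))) ?eN//.
rewrite (@res_lead _ c2 (- (e + sg a))) ?eN//.
have [->//|ab] := eqVneq b a.
have {}ab : b = ~~ a by move: ab; case: (a); case: (b).
move=> /(congr1 (fun y => y \is a GRing.unit)); rewrite !unitrM !w_lead /= ab.
by case: (a) x'au => /= -> // <-.
Qed.

Lemma level_all e0 x0 : level e0 x0 -> annih x0 ->
  forall e, exists x, level e x /\ annih x.
Proof.
move=> x0l x0w e.
have st a k : exists x, level (e0 + sg a * k%:Z) x /\ annih x.
  elim: k => [|k [x [xl xw]]]; first by exists x0; rewrite mulr0 addr0.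
  have [x' [x'l x'w]] := level_step a xl xw; exists x'; split=> //.
  by rewrite (_ : _ + _ = e0 + sg a * k%:Z + sg a)//; lia.
have [ee|ee] := leP e0 e.
  by have := st c1 `|e - e0|%N; rewrite (_ : _ + _ = e)// /sg/=; lia.
by have := st c2 `|e - e0|%N; rewrite (_ : _ + _ = e)// /sg/=; lia.
Qed.

Hypothesis levels : forall e, exists x, level e x /\ annih x.

(** An annihilator of level - i isolates the coefficient of degree i. The gap of one degree between
    the two bounds makes component [~~ a] invisible while component [a] is removed term by term;
    after that [~~ a] is removed in the same way. *)
Lemma annih_perp a n (y : bool -> int -> F) :
  ampl_le a (n - sg a) (y a) -> ampl_le (~~ a) n (y (~~ a)) ->
  (forall e x, level e x -> annih x -> res (y c1) (x c1) 0 = res (y c2) (x c2) 0) ->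
  forall b k, y b k = 0.
Proof.
move=> ya yb yw.
have yw' e x : level e x -> annih x -> res (y a) (x a) 0 = res (y (~~ a)) (x (~~ a)) 0.
  by move=> xl xw; case: (a) => /=; rewrite ?(yw e)// -(yw e).
have z1 d : ampl_le a (n - sg a * d.+1%:Z) (y a).
  elim: d => [|d IH]; first by rewrite mulr1.
  move=> k kd; have [->|kn] := eqVneq k (n - sg a * d.+1%:Z); last first.
    by apply: IH; move: kd kn; case: (a); rewrite /sg; lia.
  set i := n - sg a * d.+1%:Z in kd IH *.
  have [x [xl xw]] := levels (0 - i).
  have [xe xu] := xl.
  have := yw' _ _ xl xw.
  rewrite (res_lead IH (xe a)) (res_eq0 yb (xe (~~ a))); last first.
    by rewrite /i; case: (a); rewrite /sg/=; lia.
  by move/eqP; rewrite mulf_eq0 => /orP[/eqP//|/eqP x0]; have := xu a; rewrite x0 unitr0.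
have ya0 k : y a k = 0.
  by apply: (z1 (`|k| + `|n|)%N); case: (a); rewrite /sg; lia.
have z2 d : ampl_le (~~ a) (n - sg (~~ a) * d%:Z) (y (~~ a)).
  elim: d => [|d IH]; first by rewrite mulr0 subr0.
  move=> k kd; have [->|kn] := eqVneq k (n - sg (~~ a) * d%:Z); last first.
    by apply: IH; move: kd kn; case: (a); rewrite /sg/=; lia.
  set i := n - sg (~~ a) * d%:Z in kd IH *.
  have [x [xl xw]] := levels (0 - i).
  have [xe xu] := xl.
  have := yw' _ _ xl xw.
  rewrite (res_lead IH (xe (~~ a))) {1}/res fsum0 => [|j]; last by rewrite ya0 mul0r.
  move/esym/eqP; rewrite mulf_eq0 => /orP[/eqP//|/eqP x0].
  by have := xu (~~ a); rewrite x0 unitr0.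
have yb0 k : y (~~ a) k = 0.
  by apply: (z2 (`|k| + `|n|).+1); case: (a); rewrite /sg/=; lia.
by move=> b k; move: ya0 yb0; case: (a); case: (b).
Qed.

(** In component [a], c removes the degree [n + sg a] and g the degree n. The remainder pairs to
    zero with every annihilator and has the gap required by [annih_perp]. *)
Lemma nabla_step a n : exists c g, c \is a GRing.unit /\
  forall b k, nabla s (a, 0%N) b (w b n) k = c * w b (n + sg a) k + g * w b n k.
Proof.
pose v : tvar := (a, 0%N).
pose c := s * w a n n / w a (n + sg a) (n + sg a).
pose g := (nabla s v a (w a n) n - c * w a (n + sg a) n) / w a n n.
have cu : c \is a GRing.unit by rewrite /c unitrM unitrV unitrM s_unit !w_lead.
exists c, g; split=> //.
pose y b k := nabla s v b (w b n) k + (- c * w b (n + sg a) k + - g * w b n k).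
suff y0 : forall b k, y b k = 0.
  move=> b k; have /eqP := y0 b k; rewrite /y addrC !mulNr -opprD addrC subr_eq0.
  by move/eqP.
have nle b : ampl_le b (n + sg b) (nabla s v b (w b n)).
  by have := @nabla_le s v b n (w b n) (@w_le b n); rewrite mulr1.
apply: (@annih_perp a n).
- move=> k kn; rewrite /y.
  have [->|k1] := eqVneq k n.
    by rewrite /g !mulNr divrK// opprB addrCA addrA -addrA addrC; ring.
  have [->|k2] := eqVneq k (n + sg a).
    rewrite {1}/nabla /v/= eqxx mulr1 addrK [w a n (n + sg a)]w_le ?(tder0 derD).
      by rewrite mulr0 addr0 add0r mulNr /c divrK ?subrr.
    by case: (a); rewrite /sg; lia.
  by rewrite nle ?w_le ?mulr0 ?addr0//; move: kn k1 k2; case: (a); rewrite /sg; lia.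
- move=> k kn; rewrite /y /nabla /v/=; have -> : (a == ~~ a) = false by case: (a).
  by rewrite !w_le ?(tder0 derD) ?mulr0 ?addr0//; move: kn; case: (a); rewrite /sg/=; lia.
- move=> e x [xe _] xw.
  have exp b : res (y b) (x b) 0 = res (nabla s v b (w b n)) (x b) 0 +
      (- c * res (w b (n + sg a)) (x b) 0 + - g * res (w b n) (x b) 0).
    have [f [f1 f2]] : exists f, ampl_le b f (w b (n + sg a)) /\ ampl_le b f (w b n).
      exists (n + sg b); split; apply: (ampl_leW _ (@w_le b _));
      by case: (a); case: (b); rewrite /sg; lia.
    rewrite (resDl (e := f) _ (nle b) _ (xe b)); last first.
      by move=> k kf; rewrite f1// f2// !mulr0 addr0.
    by rewrite (resDl _ (ampl_leZ _ f1) (ampl_leZ _ f2) (xe b)) !resZl.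
  by rewrite !exp (xw n [:: v]) (xw _ [::]) (xw n [::]).
Qed.

(** Pairing [nabla_step] with [phi] expresses D g(n) by c g(n + sg a) and a multiple of g(n). A zero
    of g at n thus spreads to n + 1 and n - 1, and then everywhere. *)
Lemma pairing_nonvanishing (g : int -> F) e (phi : bool -> int -> F) :
  (forall a, ampl_le a e (phi a)) ->
  (forall n, g n = res (w c1 n) (phi c1) 0 + res (w c2 n) (phi c2) 0) ->
  (forall v n, D v (g n) = res (nabla s v c1 (w c1 n)) (phi c1) 0
                         + res (nabla s v c2 (w c2 n)) (phi c2) 0) ->
  forall k, g k != 0 -> forall n, g n != 0.
Proof.
move=> phie gE dgE k gk n; apply: contra_neq gk => gn.
have step a i : g i = 0 -> g (i + sg a) = 0.
  move=> gi; have [c [h [cu nE]]] := nabla_step a i.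
  have exp b : res (nabla s (a, 0%N) b (w b i)) (phi b) 0 =
      c * res (w b (i + sg a)) (phi b) 0 + h * res (w b i) (phi b) 0.
    rewrite -!resZl -(resDl _ (ampl_leZ c (@w_le b _)) (ampl_leZ h (@w_le b _)) (phie b)).
    by apply: eq_fsum => j; rewrite nE.
  have := dgE (a, 0%N) i; rewrite gi (tder0 derD) !exp addrACA -!mulrDr -!gE gi mulr0.
  rewrite addr0 => /esym/eqP; rewrite mulf_eq0 => /orP[/eqP c0|/eqP//].
  by rewrite c0 unitr0 in cu.
have steps a j : g (n + sg a * j%:Z) = 0.
  elim: j => [|j IH]; first by rewrite mulr0 addr0.
  by rewrite (_ : _ + _ = n + sg a * j%:Z + sg a) ?step//; lia.
have [nk|nk] := leP n k.
  by have := steps c1 `|k - n|%N; rewrite (_ : _ + _ = k)// /sg/=; lia.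
by have := steps c2 `|k - n|%N; rewrite (_ : _ + _ = k)// /sg/=; lia.
Qed.

End Annihilator.

(** * Taylor expansions in y *)

Section Monomials.
Implicit Types (al : monom) (x : tvar) (a : bool).
Local Notation "x +` al" := (msetD (msetn 1 x) al) : ring_scope.

Lemma big_finsuppD1 (R : Type) (idx : R) (op : Monoid.com_law idx)
    (f : tvar -> nat -> R) x al : (forall i, f i 0%N = idx) ->
  \big[op/idx]_(i <- finsupp al) f i (al i) =
  op (f x (al x)) (\big[op/idx]_(i <- (finsupp al `\ x)%fset) f i (al i)).
Proof.
move=> f0; have [xal|xal] := boolP (x \in finsupp al); first exact: big_fsetD1.
by rewrite mem_fsetD1// (fsfun_dflt xal) f0 Monoid.mul1m.
Qed.

Lemma big_finsupp1D (R : Type) (idx : R) (op : Monoid.com_law idx)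
    (f : tvar -> nat -> R) x al : (forall i, f i 0%N = idx) ->
  \big[op/idx]_(i <- finsupp (x +` al)) f i ((x +` al) i) =
  op (f x (al x).+1) (\big[op/idx]_(i <- (finsupp al `\ x)%fset) f i (al i)).
Proof.
move=> f0; rewrite (big_finsuppD1 _ x)// mset1DE eqxx add1n; congr (op _ _).
have -> : (finsupp (x +` al) `\ x = finsupp al `\ x)%fset.
  apply/fsetP => i; rewrite !in_fsetD1 !msuppE in_mset1D.
  by case: eqVneq.
apply: eq_big_seq => i; rewrite in_fsetD1 mset1DE => /andP[/negPf-> _].
by rewrite add0n.
Qed.

Lemma mfact1D x al : mfact (x +` al) = ((al x).+1 * mfact al)%N.
Proof.
rewrite /mfact (big_finsupp1D _ (f := fun _ k => k`!))// (big_finsuppD1 _ (f := fun _ k => k`!) x)//.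
by rewrite factS mulnA.
Qed.

Lemma mdeg1D x al : mdeg (x +` al) = (mdeg al).+1.
Proof.
rewrite /mdeg (big_finsupp1D _ (f := fun _ k => k))// (big_finsuppD1 _ (f := fun _ k => k) x)//.
Qed.

Lemma mweight1D x al : mweight (x +` al) = (x.2.+1 + mweight al)%N.
Proof.
rewrite /mweight (big_finsupp1D _ (f := fun i k => (k * i.2.+1)%N))//.
rewrite (big_finsuppD1 _ (f := fun i k => (k * i.2.+1)%N) x)//.
by rewrite mulSn addnA.
Qed.

Lemma in_comp1D a x al : in_comp a (x +` al) = (x.1 == a) && in_comp a al.
Proof.
apply/allP/andP => [H|[xa /allP H] i].
  split; first by apply: H; rewrite msuppE in_mset1D eqxx.
  by apply/allP => i ial; apply: H; rewrite msuppE in_mset1D -msuppE ial orbT.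
by rewrite msuppE in_mset1D => /orP[/eqP->//|]; rewrite -msuppE => /H.
Qed.

Lemma finsupp_mset0 : finsupp (mset0 : monom) = fset0.
Proof. exact: finsupp0. Qed.

Lemma mfact0 : mfact mset0 = 1%N.
Proof. by rewrite /mfact finsupp_mset0 big_seq_fset0. Qed.

Lemma mdeg0 : mdeg mset0 = 0%N.
Proof. by rewrite /mdeg finsupp_mset0 big_seq_fset0. Qed.

Lemma mweight0 : mweight mset0 = 0%N.
Proof. by rewrite /mweight finsupp_mset0 big_seq_fset0. Qed.

Lemma in_comp0 a : in_comp a mset0.
Proof. by rewrite /in_comp finsupp_mset0. Qed.

Lemma monom_ind (P : monom -> Prop) :
  P mset0 -> (forall x al, P al -> P (x +` al)) -> forall al, P al.
Proof.
move=> P0 PS al; rewrite -(seq_mset_id al); elim: (EnumMset.f al) => [|x s IH].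
  by rewrite (_ : seq_mset [::] = mset0)//; apply/msetP => i; rewrite mset_seqE mset0E.
by rewrite mset_cons; apply: PS.
Qed.

Definition splits al : set (monom * monom) := [set p | msetD p.1 p.2 = al].

Lemma splits0 : splits mset0 = [set (mset0, mset0)].
Proof.
apply/seteqP; split=> [[b c] /= bc|_ -> /=]; last by rewrite /splits /= mset0D.
have bc0 i : (b i + c i = 0)%N by have /msetP/(_ i) := bc; rewrite msetE2 mset0E.
by congr (_, _); apply/msetP => i; rewrite mset0E; have := bc0 i; lia.
Qed.

Lemma splits1D x al p : splits (x +` al) p ->
  (0 < p.1 x)%N -> exists2 q, splits al q & p = (x +` q.1, q.2).
Proof.
case: p => b c /= bc bx; exists ((b `\ x)%mset, c) => /=; last first.
  by rewrite msetB1K// -mset_gt0.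
apply/msetP => i; have /msetP/(_ i) := bc; rewrite /= !msetE2 !msetnE.
by have [->|] := eqVneq i x; move: bx; rewrite /=; lia.
Qed.

Lemma splits_swap al p : splits al p -> splits al (p.2, p.1).
Proof. by rewrite /splits /= msetDC. Qed.

Lemma splits_1D x al p : splits al p -> splits (x +` al) (x +` p.1, p.2).
Proof. by rewrite /splits /= => <-; rewrite msetDA. Qed.

Lemma finite_splits al : finite_set (splits al).
Proof.
elim/monom_ind: al => [|x al IH]; first by rewrite splits0; apply: finite_set1.
pose h (q : monom * monom) := (x +` q.1, q.2).
pose h' (q : monom * monom) := (q.1, x +` q.2).
apply: (@sub_finite_set _ _ (h @` splits al `|` h' @` splits al)); last first.
  by rewrite finite_setU; split; apply: finite_image.
move=> p pal; have [p1|p1] := ltnP 0 (p.1 x).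
  by left; have [q q1 ->] := splits1D pal p1; exists q.
right; have p2 : (0 < p.2 x)%N.
  have /msetP/(_ x) := pal; rewrite !msetE2 msetnE eqxx; lia.
have [q q1 E] := splits1D (splits_swap pal) p2.
exists (q.2, q.1); first exact: splits_swap.
by move: E; case: (p) => b c [-> ->].
Qed.

Variable (F : idomainType).

Lemma fsum_splits_swap al (f : monom * monom -> F) :
  \sum_(p \in splits al) f p = \sum_(p \in splits al) f (p.2, p.1).
Proof.
apply: reindex_fsbig; split.
- by move=> p; apply: splits_swap.
- by move=> [b c] [b' c'] _ _ [-> ->].
- by move=> [b c] pal; exists (c, b); first exact: (splits_swap pal).
Qed.

(** The factor [p.1 x] kills the splittings whose first part lacks x; the others come from
    splittings of [al] by adding x to the first part. *)
Lemma fsum_splits1D_l x al (f : monom * monom -> F) :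
  \sum_(p \in splits (x +` al)) (p.1 x)%:R * f p =
  \sum_(p \in splits al) (p.1 x).+1%:R * f (x +` p.1, p.2).
Proof.
pose h (q : monom * monom) := (x +` q.1, q.2).
transitivity (\sum_(p \in h @` splits al) (p.1 x)%:R * f p).
  apply/esym/fsbig_widen => [_ [q ql <-]|p [pal /= pN]]; first exact: splits_1D.
  rewrite (_ : p.1 x = 0%N) ?mul0r//; apply/eqP; rewrite -leqn0 leqNgt.
  by apply/negP => /(splits1D pal)[q ql pE]; apply: pN; exists q.
rewrite fsbig_image.
  by apply: eq_fsbigr => q _; rewrite /= mset1DE eqxx add1n.
move=> [b c] [b' c'] _ _ [bb ->]; congr (_, _).
by apply/msetP => i; have /msetP/(_ i) := bb; rewrite !mset1DE => /addnI.
Qed.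

(* The Leibniz rule for the derivation with respect to y_x. *)
Lemma fsum_splits1D x al (f : monom * monom -> F) :
  (al x).+1%:R * \sum_(p \in splits (x +` al)) f p =
  \sum_(p \in splits al) ((p.1 x).+1%:R * f (x +` p.1, p.2)
                          + (p.2 x).+1%:R * f (p.1, x +` p.2)).
Proof.
rewrite (fsbig_split _ _ _ (finite_splits al)) /= -fsum_splits1D_l.
rewrite [X in _ + X]fsum_splits_swap /=.
rewrite -(fsum_splits1D_l x al (fun p => f (p.2, p.1))) [X in _ + X]fsum_splits_swap /=.
rewrite -(fsbig_split _ _ _ (finite_splits _)) /= mulr_fsumr.
apply: eq_fsbigr => -[b c]; rewrite inE => /msetP/(_ x).
by rewrite !msetE2 msetnE eqxx add1n /= -mulrDl -natrD => ->.
Qed.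

End Monomials.

(** * Coefficients in y of products of two waves *)

Section TaylorExpansion.
Variables (F : idomainType) (D : tvar -> F -> F).
Hypothesis charF : forall k : nat, (k.+1%:R : F) \is a GRing.unit.
Hypothesis derD : forall v : tvar, is_derivation (D v).
Hypothesis commD : forall (v w : tvar) (f : F), D v (D w f) = D w (D v f).
Implicit Types (al : monom) (x : tvar) (a : bool) (u v : int -> F).
Local Notation "x +` al" := (msetD (msetn 1 x) al) : ring_scope.

(** [mderiv] runs over the support of [al], which changes with [al]. As the derivations commute, any
    duplicate-free list containing the support may be used, so two monomials can be compared along
    one list. *)
Definition mderiv_on al (r : seq tvar) (f : F) : F :=
  foldr (fun i g => iter (al i) (D i) g) f r.

Lemma iter_comm x y k f : iter k (D x) (D y f) = D y (iter k (D x) f).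
Proof. by elim: k => //= k ->; rewrite commD. Qed.

Lemma mderiv_on_comm al r x f : mderiv_on al r (D x f) = D x (mderiv_on al r f).
Proof. by elim: r => //= i r ->; rewrite iter_comm. Qed.

Lemma mderiv_on_iter_comm al r x k f :
  mderiv_on al r (iter k (D x) f) = iter k (D x) (mderiv_on al r f).
Proof. by elim: k => //= k <-; rewrite mderiv_on_comm. Qed.

Lemma mderiv_on_mem al r x f : x \in r ->
  mderiv_on al r f = iter (al x) (D x) (mderiv_on al (rem x r) f).
Proof.
elim: r => //= i r IH; rewrite inE eq_sym; case: eqVneq => [->//|ix /=] /IH -> /=.
have sw : mderiv_on al [:: i] (iter (al x) (D x) (mderiv_on al (rem x r) f)) =
          iter (al x) (D x) (mderiv_on al [:: i] (mderiv_on al (rem x r) f)).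
  exact: mderiv_on_iter_comm.
exact: sw.
Qed.

Lemma perm_mderiv_on al r r' f : perm_eq r r' ->
  mderiv_on al r f = mderiv_on al r' f.
Proof.
elim: r r' => [|i r IH] r' rr'.
  by move: rr'; rewrite perm_sym => /perm_nilP ->.
have ir' : i \in r' by rewrite -(perm_mem rr') inE eqxx.
rewrite (mderiv_on_mem _ _ ir') /=; congr iter; apply: IH.
by rewrite -(perm_cons i) (perm_trans rr')// perm_to_rem.
Qed.

Lemma mderivE al r f : uniq r -> {subset finsupp al <= r} ->
  mderiv D al f = mderiv_on al r f.
Proof.
move=> ur sr.
have -> : mderiv_on al r f = mderiv_on al [seq i <- r | al i != 0%N] f.
  elim: (r) => //= i r' ->; case: eqVneq => [->//|//].
apply: perm_mderiv_on; apply: uniq_perm => [|| i]; [exact: fset_uniq|exact: filter_uniq|].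
rewrite mem_filter mset_neq0 -msuppE; apply/idP/andP => [il|[]//].
by split=> //; apply: sr.
Qed.

Lemma mderiv1D x al f : mderiv D (x +` al) f = mderiv D al (D x f).
Proof.
pose r : seq tvar := (x |` finsupp al)%fset.
have ur : uniq r by exact: fset_uniq.
have xr : x \in r by rewrite fset1U1.
rewrite (@mderivE _ r)//; last first.
  by move=> i; rewrite in_fset1U msuppE in_mset1D -msuppE.
rewrite (@mderivE al r)//; last by move=> i; apply: fset1Ur.
rewrite !(mderiv_on_mem _ _ xr) mset1DE eqxx add1n iterS mderiv_on_comm iter_comm.
congr (D x (iter _ _ _)).
have : x \notin rem x r by rewrite mem_rem_uniq// inE eqxx.
elim: (rem x r) => //= i r' IH; rewrite inE negb_or => /andP[xi /IH ->].
by rewrite mset1DE eq_sym (negPf xi) add0n.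
Qed.

Lemma mderiv0 f : mderiv D mset0 f = f.
Proof. by rewrite /mderiv finsupp_mset0. Qed.

Lemma mderivD al f g : mderiv D al (f + g) = mderiv D al f + mderiv D al g.
Proof.
elim/monom_ind: al f g => [|x al IH] f g; first by rewrite !mderiv0.
by rewrite !mderiv1D (tderD derD) IH.
Qed.

Lemma mderivZ al c f : (forall x, D x c = 0) ->
  mderiv D al (c * f) = c * mderiv D al f.
Proof.
move=> c0; elim/monom_ind: al f => [|x al IH] f; first by rewrite !mderiv0.
by rewrite !mderiv1D (tderM derD) c0 mul0r add0r IH.
Qed.

Lemma mderiv_zero al : mderiv D al 0 = 0.
Proof. by apply: (addIr (mderiv D al 0)); rewrite -mderivD !add0r. Qed.

Lemma mfact_unit al : ((mfact al)%:R : F) \is a GRing.unit.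
Proof.
elim/monom_ind: al => [|x al IH]; first by rewrite mfact0.
by rewrite mfact1D natrM unitrM IH charF.
Qed.

Lemma ampl_le_mderiv al a d u : ampl_le a d u -> ampl_le a d (mderiv D al \o u).
Proof. by move=> ud k kd; rewrite /= ud// mderiv_zero. Qed.

(** The share of one splitting of a monomial: [p.1] is taken from the Taylor expansion of u(t'),
    [p.2] from the exponential. *)
Definition wave_coef (s : F) a u v (k : int) (p : monom * monom) : F :=
  (if in_comp a p.2 then s ^+ mdeg p.2 / (mfact p.2)%:R else 0) / (mfact p.1)%:R
  * res (mderiv D p.1 \o u) v (k - sg a * (mweight p.2)%:Z).

Lemma pmul_at_t f g al :
  pmul (at_t' D f) (at_t'' g) al = mderiv D al f / (mfact al)%:R * g.
Proof.
rewrite /pmul -(@fsbig_widen _ _ _ _ [set (al, mset0)]) ?fsbig_set1 /at_t''/=.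
- by rewrite eqxx.
- by move=> _ ->; rewrite /= msetD0.
- move=> [b c] /= [bc bcN]; case: eqP => [c0|]; last by rewrite mulr0.
  by case: bcN; rewrite -bc c0 msetD0.
Qed.

Lemma fsum_big (I : choiceType) (J : eqType) (r : seq J) (f : J -> I -> F) :
  (forall j, fin_supp (f j)) ->
  \sum_(i \in [set: I]) \sum_(j <- r) f j i =
  \sum_(j <- r) \sum_(i \in [set: I]) f j i.
Proof.
move=> fj; elim: r => [|j r IH].
  by rewrite big_nil fsum0// => i; rewrite big_nil.
have fr : fin_supp (fun i => \sum_(j <- r) f j i).
  elim: (r) => [|l r' [A hA]].
    by exists fset0 => i _; rewrite big_nil.
  have [B hB] := fj l; exists (A `|` B)%fset => i.
  by rewrite inE negb_or big_cons => /andP[/hA -> /hB ->]; rewrite addr0.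
by rewrite big_cons -IH -fsumD//; apply: eq_fsum => i; rewrite big_cons.
Qed.

(** A monomial of the exponential occurs with a single power of z, given by its weight, so the
    convolution in z reduces to one term per splitting. *)
Lemma wave_mulE s a u v k al :
  wave_mul D s a u v k al = \sum_(p \in splits al) wave_coef s a u v k p.
Proof.
rewrite /wave_mul {1}/zmul /pmul.
rewrite [RHS](fsbig_finite _ _ (finite_splits al)).
under eq_fsum => i do rewrite (fsbig_finite _ _ (finite_splits al)).
have cE (p : monom * monom) i : zmul (fun k => at_t' D (u k)) (fun k => at_t'' (v k)) i p.1
    = res (mderiv D p.1 \o u) v i / (mfact p.1)%:R.
  rewrite /zmul /res mulr_fsuml; apply: eq_fsum => j.
  by rewrite pmul_at_t /= mulrAC.
have zE p i : i != k - sg a * (mweight p.2)%:Z -> zexp s a (k - i) p.2 = 0 :> F.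
  move=> ik; rewrite /zexp; case: andP => // -[_ /eqP kE]; case/eqP: ik.
  by move: kE; rewrite /sg /c1; case: (a) => /=; lia.
rewrite fsum_big => [|p]; last first.
  exists [fset k - sg a * (mweight p.2)%:Z]%fset => i; rewrite inE => ik.
  by rewrite zE ?mulr0.
apply: eq_bigr => p _.
rewrite (@fsum1 _ _ _ (k - sg a * (mweight p.2)%:Z)) => [|i ik]; last by rewrite zE ?mulr0.
rewrite cE /wave_coef /zexp subKr.
have -> : (sg a * (mweight p.2)%:Z == (if a == c1 then (mweight p.2)%:Z else - (mweight p.2)%:Z)).
  by rewrite /sg /c1; case: (a) => /=; lia.
by rewrite andbT mulrC mulrA mulrAC.
Qed.

Lemma wave_mul0 s a u v k : wave_mul D s a u v k mset0 = res u v k.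
Proof.
rewrite wave_mulE splits0 fsbig_set1 /wave_coef /= in_comp0 mdeg0 mfact0 mweight0.
rewrite expr0 !divr1 mul1r mulr0 subr0.
by apply: eq_fsum => i; rewrite /= mderiv0.
Qed.

(** Differentiation in y_x acts on u(t') and on the exponential, which together is [nabla]. Iterated
    down to y = 0, it turns every Taylor coefficient into a plain residue. *)
Lemma wave_mul1D s a d e u v k x al : (forall y, D y s = 0) ->
  ampl_le a d u -> ampl_le a e v ->
  (al x).+1%:R * wave_mul D s a u v k (x +` al) =
  wave_mul D s a (nabla D s x a u) v k al.
Proof.
move=> s0 ud ve; rewrite !wave_mulE fsum_splits1D; apply: eq_fsbigr => -[b c] _ /=.
rewrite /wave_coef /= !mfact1D mdeg1D mweight1D in_comp1D.
have bu := mfact_unit b; have cu := mfact_unit c.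
have bxu := charF (b x); have cxu := charF (c x).
set K := k - sg a * (mweight c)%:Z.
have -> : k - sg a * (x.2.+1 + mweight c)%N%:Z = K - sg a * x.2.+1%:Z.
  by rewrite /K; case: (a); rewrite /sg; lia.
have -> : res (mderiv D b \o nabla D s x a u) v K =
    res (mderiv D (x +` b) \o u) v K +
    (if x.1 == a then s * res (mderiv D b \o u) v (K - sg a * x.2.+1%:Z) else 0).
  rewrite /nabla; case: eqP => _; last first.
    by rewrite addr0; apply: eq_fsum => i; rewrite /= addr0 mderiv1D.
  rewrite -res_shift -resZl -(resDl (a := a) (d := d) (e := d + sg a * x.2.+1%:Z) _ _ _ ve).
  - by apply: eq_fsum => i; rewrite /= mderivD mderivZ// mderiv1D.
  - exact: ampl_le_mderiv.
  - apply: ampl_leZ => i id; apply: (ampl_le_mderiv b ud).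
    by move: id; case: (a); rewrite /sg; lia.
rewrite !natrM exprS; set R1 := res _ _ _; set R2 := res _ _ _.
have cancel (A B C X R : F) : A \is a GRing.unit -> B \is a GRing.unit ->
    A * (X / (A * B) * C * R) = X / B * C * R.
  by move=> Au Bu; rewrite invrM//; have H := divrr Au; ring: H.
rewrite mulrDr; congr (_ + _).
  by rewrite -[X in _ * (X * R1)]mulr1 cancel// mulr1.
case: (x.1 == a) => /=; last by rewrite !mul0r !mulr0.
case: ifP => _; last by rewrite !mul0r mulr0.
by rewrite cancel// -!mulrA mulrCA; congr (_ * _); rewrite mulrCA; congr (_ * _); rewrite mulrCA.
Qed.

End TaylorExpansion.

(** * Bilinear systems *)

Section BilinearSystem.
Variables (F : idomainType) (D : tvar -> F -> F).
Hypothesis charF : forall k : nat, (k.+1%:R : F) \is a GRing.unit.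
Hypothesis derD : forall v : tvar, is_derivation (D v).
Hypothesis commD : forall (v w : tvar) (f : F), D v (D w f) = D w (D v f).
Implicit Types (al : monom) (x v : tvar) (a : bool).
Local Notation "x +` al" := (msetD (msetn 1 x) al) : ring_scope.
Local Notation wave_mul1D := (wave_mul1D charF derD commD).

Lemma wave_mulZr s a u y c k al :
  wave_mul D s a u (fun i => c * y i) k al = c * wave_mul D s a u y k al.
Proof.
rewrite !wave_mulE mulr_fsumr; apply: eq_fsbigr => p _.
by rewrite /wave_coef resZr mulrCA.
Qed.

Lemma wave_mulDr s a d e f u y z k al :
  ampl_le a d u -> ampl_le a e y -> ampl_le a f z ->
  wave_mul D s a u (fun i => y i + z i) k al =
  wave_mul D s a u y k al + wave_mul D s a u z k al.
Proof.
move=> ud ye zf; rewrite !wave_mulE -(fsbig_split _ _ _ (finite_splits al)) /=.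
apply: eq_fsbigr => p _.
by rewrite /wave_coef (resDr _ (ampl_le_mderiv derD commD p.1 ud) ye zf) mulrDr.
Qed.

Lemma wave_mul_annih s d e (u1 u2 y1 y2 : int -> F) : (forall x, D x s = 0) ->
  ampl_le c1 d u1 -> ampl_le c2 d u2 -> ampl_le c1 e y1 -> ampl_le c2 e y2 ->
  (forall al, wave_mul D s c1 u1 y1 0 al = wave_mul D s c2 u2 y2 0 al) ->
  forall l, res (nablas D s l c1 u1) y1 0 = res (nablas D s l c2 u2) y2 0.
Proof.
move=> s0 u1d u2d y1e y2e E l.
suff E' al : wave_mul D s c1 (nablas D s l c1 u1) y1 0 al =
              wave_mul D s c2 (nablas D s l c2 u2) y2 0 al.
  by have := E' mset0; rewrite !wave_mul0.
elim: l al => [//|x l IH] al.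
have [f1 n1] := nablas_le derD s l u1d; have [f2 n2] := nablas_le derD s l u2d.
by rewrite -(wave_mul1D _ _ _ s0 n1 y1e) -(wave_mul1D _ _ _ s0 n2 y2e) IH.
Qed.

Lemma at_t'_0 f : at_t' D f mset0 = f.
Proof. by rewrite /at_t' mderiv0 mfact0 divr1. Qed.

Lemma at_t'_1 f x : at_t' D f (x +` mset0) = D x f.
Proof. by rewrite /at_t' mderiv1D// mderiv0 mfact1D mset0E mfact0 divr1. Qed.

Variables (s : F) (w : bool -> int -> int -> F).
Hypothesis s_const : forall x, D x s = 0.
Hypothesis s_unit : s \is a GRing.unit.
Hypothesis w_le : forall a n, ampl_le a n (w a n).
Hypothesis w_lead : forall a n, w a n n \is a GRing.unit.

(** Common form of the equations for q and r, with j in the place of n''. For q: s = 1, eta = -1, h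
    = q, and [x j] is the dual wave of index j + 1. For r: s = -1, eta = 1, h(j) = r(j + 1), g(n) =
    r(1 - n), [x j] is the wave of index j, and [w] consists of the dual waves of index 1 - n. *)
Variables (g : int -> F) (phi : int -> bool -> int -> F) (eta : F).
Variables (h : int -> F) (x : int -> bool -> int -> F) (e e' : int -> int).
Hypothesis eta_unit : eta \is a GRing.unit.
Hypothesis phi_le : forall j a, ampl_le a (e' j) (phi j a).
Hypothesis x_level : forall j, level (e j) (x j).
Hypothesis phi_diff : forall j a k,
  phi (j + 1) a k = phi j a k + (if a then - eta else eta) * h j * x j a k.
Hypothesis bilinear : forall n j al, at_t' D (g n) al =
  wave_mul D s c1 (w c1 n) (phi j c1) 0 al + wave_mul D s c2 (w c2 n) (phi j c2) 0 al.

Lemma pairing_eq n j :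
  g n = res (w c1 n) (phi j c1) 0 + res (w c2 n) (phi j c2) 0.
Proof. by have := bilinear n j mset0; rewrite at_t'_0 !wave_mul0. Qed.

Lemma pairing_deriv v n j : D v (g n) =
  res (nabla D s v c1 (w c1 n)) (phi j c1) 0 + res (nabla D s v c2 (w c2 n)) (phi j c2) 0.
Proof.
have := bilinear n j (v +` mset0); rewrite at_t'_1 => ->.
have W a := wave_mul1D (a := a) 0 v mset0 s_const (@w_le a n) (@phi_le j a).
have {}W a : wave_mul D s a (w a n) (phi j a) 0 (v +` mset0) =
    res (nabla D s v a (w a n)) (phi j a) 0.
  by have := W a; rewrite mset0E mul1r wave_mul0.
by rewrite !W.
Qed.

Lemma bilinear_annih j : h j != 0 -> annih D s w (x j).
Proof.
move=> hj n; have [xe _] := x_level j.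
apply: (wave_mul_annih s_const (@w_le c1 n) (@w_le c2 n) (xe c1) (xe c2)) => al.
have W a : wave_mul D s a (w a n) (phi (j + 1) a) 0 al =
    wave_mul D s a (w a n) (phi j a) 0 al
    + (if a then - eta else eta) * h j * wave_mul D s a (w a n) (x j a) 0 al.
  have -> : phi (j + 1) a =
      fun k => phi j a k + (if a then - eta else eta) * h j * x j a k.
    by apply/funext => k; rewrite phi_diff.
  rewrite -wave_mulZr.
  by rewrite -(wave_mulDr _ _ _ (@w_le a n) (@phi_le j a) (ampl_leZ _ (xe a))).
(* The left side does not depend on j, so subtraction leaves eta h(j) times a difference of
   pairings; the opposite signs in [phi_diff] produce that difference. *)
have := bilinear n (j + 1) al; rewrite (bilinear n j) !W addrACA.
move/eqP; rewrite -subr_eq0 opprD addNKr oppr_eq0 /= !mulNr subr_eq0.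
by move/eqP/mulfI; apply; rewrite mulf_neq0//; apply: contraTneq eta_unit => ->; rewrite unitr0.
Qed.

Lemma bilinear_nonvanishing j n : h j != 0 -> g n != 0 -> forall n', g n' != 0.
Proof.
move=> hj; have := bilinear_annih hj; have := x_level j => xl xw.
have lev := level_all derD s_unit w_le w_lead xl xw.
move: n; refine (pairing_nonvanishing derD s_unit w_le w_lead lev (@phi_le j) _ _).
- by move=> n'; apply: pairing_eq.
- by move=> v n'; apply: pairing_deriv.
Qed.

End BilinearSystem.

Section LinearCombinations.
Variable F : idomainType.

Lemma res_fsum a (c : int -> F) (y : int -> int -> F) f phi :
  fin_supp c -> (forall l, exists d, ampl_le a d (y l)) -> ampl_le a f phi ->
  res (fun k => \sum_(l \in [set: int]) c l * y l k) phi 0 =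
  \sum_(l \in [set: int]) c l * res (y l) phi 0.
Proof.
move=> [A cA] yd phif; rewrite [RHS](@fsumE _ _ _ A) => [|l /cA ->]; last by rewrite mul0r.
have E l : c l * res (y l) phi 0 =
    \sum_(i \in [set: int]) c l * (y l i * phi (0 - i)) by rewrite mulr_fsumr.
rewrite (eq_bigr _ (fun l _ => E l)) -fsum_big => [|l]; last first.
  have [d yl] := yd l; have [B yB] := res_supp 0 yl phif.
  by exists B => i /yB ->; rewrite mulr0.
apply: eq_fsum => i; rewrite (@fsumE _ _ _ A) => [|l /cA ->]; last by rewrite mul0r.
by rewrite mulr_suml; apply: eq_bigr => l _; rewrite mulrA.
Qed.

Lemma pairing_fsum (c : int -> F) (y : bool -> int -> int -> F) f (phi : bool -> int -> F) g :
  fin_supp c -> (forall a l, exists d, ampl_le a d (y a l)) ->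
  (forall a, ampl_le a f (phi a)) ->
  (forall l, g l = res (y c1 l) (phi c1) 0 + res (y c2 l) (phi c2) 0) ->
  res (fun k => \sum_(l \in [set: int]) c l * y c1 l k) (phi c1) 0 +
  res (fun k => \sum_(l \in [set: int]) c l * y c2 l k) (phi c2) 0 =
  \sum_(l \in [set: int]) c l * g l.
Proof.
move=> cfin yd phif gE; have [A cA] := cfin.
rewrite (res_fsum cfin (yd c1) (phif c1)) (res_fsum cfin (yd c2) (phif c2)) -fsumD.
- by apply: eq_fsum => l; rewrite gE mulrDr.
- by exists A => l /cA ->; rewrite mul0r.
- by exists A => l /cA ->; rewrite mul0r.
Qed.

End LinearCombinations.

(** * Wave operators *)

Section WaveOperators.
Variables (F : idomainType) (D : tvar -> F -> F).
Hypothesis derD : forall v : tvar, is_derivation (D v).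
Variables w ws : bool -> int -> int -> F.
Hypothesis w_le : forall a n, ampl_le a n (w a n).
Hypothesis w_lead : forall a n, w a n n \is a GRing.unit.
Hypothesis w1_lead : forall n, w c1 n n = 1.
Hypothesis ws_le : forall a n, ampl_le a (1 - n) (ws a n).
Hypothesis ws1_lead : forall n, ws c1 n (1 - n) = 1.
Hypothesis orth : forall n n',
  res (w c1 n) (ws c1 n') 0 = res (w c2 n) (ws c2 n') 0.
Hypothesis orth_deriv : forall v n n',
  res (nabla D 1 v c1 (w c1 n)) (ws c1 n') 0 =
  res (nabla D 1 v c2 (w c2 n)) (ws c2 n') 0.
Implicit Types (a : bool) (v : tvar).

(* [w a n] is the amplitude of A (z^n) for A := wave_op (w a), and [ws a n] is
   T^* (z^(n-1)), where T := dual_op a, with z replaced by z^-1. *)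
Definition wave_op (u : int -> int -> F) : op F := fun j n => u n (n + j).
Definition dual_op a : op F := fun d i => ws a (d + i + 1) (- i).
Local Notation S := (fun a => wave_op (w a)).
Local Notation T := dual_op.

Lemma wave_op_dual u a j n :
  omul (wave_op u) (T a) j n = res (u n) (ws a (n + j + 1)) 0.
Proof.
rewrite /omul /res (@reindex_fsum _ _ (fun i => i - n) (fun i => i + n)).
- apply: eq_fsum => i; rewrite /wave_op /dual_op; congr (u n _ * ws a _ _); lia.
- by move=> i; rewrite subrK.
- by move=> i; rewrite addrK.
Qed.

Lemma wave_op_Lam_dual d a j n :
  omul (omul (S a) (oLam F d)) (T a) j n = res (w a n) (ws a (n + j + 1)) (- d).
Proof.
have -> : omul (S a) (oLam F d) = wave_op (fun n k => w a n (k - d)).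
  apply/funext => i; apply/funext => k; rewrite omul_LamE /wave_op.
  by congr (w a k _); lia.
by rewrite wave_op_dual res_shift sub0r.
Qed.

Lemma wave_op_le a : ordle a 0 (S a).
Proof. by move=> j n jn; apply: w_le; case: (a) jn; rewrite /sg; lia. Qed.

Lemma dual_op_le a : ordle a 0 (T a).
Proof. by move=> j n jn; apply: ws_le; case: (a) jn; rewrite /sg; lia. Qed.

Lemma wave_op_lead n : S c1 0 n = 1.
Proof. by rewrite /wave_op addr0 w1_lead. Qed.

(** Orthogonality says S_1 T_1 = S_2 T_2. The left side has no positive powers of Lambda and the
    right side no negative ones; the normalized leading terms of the first component give the
    coefficient 1. *)
Lemma wave_op_dual1 a : omul (S a) (T a) = oLam F 0.
Proof.
have E : omul (S c1) (T c1) = omul (S c2) (T c2).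
  by apply/funext => j; apply/funext => n; rewrite !wave_op_dual orth.
suff {a} S1 : omul (S c1) (T c1) = oLam F 0 by case: a; rewrite -?E.
apply/funext => j; apply/funext => n; rewrite /oLam.
have [->|j0] := eqVneq j 0.
  have := omul_lead n (@wave_op_le c1) (@dual_op_le c1); rewrite addr0 => ->.
  rewrite wave_op_lead mul1r /dual_op.
  by have := ws1_lead (n + 1); congr (ws _ _ _ = _); lia.
have [jn|jp] := ltP j 0.
  by rewrite E (ordle_mul (@wave_op_le c2) (@dual_op_le c2))// /sg/=; lia.
by rewrite (ordle_mul (@wave_op_le c1) (@dual_op_le c1))// /sg/=; move: j0; lia.
Qed.

Lemma wave_op_dual2 a : omul (T a) (S a) = oLam F 0.
Proof.
apply: omul_inv_sym (@wave_op_le a) (@dual_op_le a) _ (wave_op_dual1 a) => n.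
rewrite /wave_op addr0; apply: contraTneq (w_lead a n) => ->.
by rewrite unitr0.
Qed.

Lemma sato_lhs_wave v a :
  sato_lhs D S v a = wave_op (fun n => nabla D 1 v a (w a n)).
Proof.
apply/funext => j; apply/funext => n.
rewrite /sato_lhs /oadd /oder /wave_op /nabla /flow_sym; congr (_ + _).
case: eqP => _; last by rewrite omul0r.
by rewrite omul_LamE mul1r; congr (w a n _); lia.
Qed.

Lemma flow_op_wave v : omul (sato_lhs D S v c2) (T c2) = flow_op D S T v.
Proof.
apply/funext => j; apply/funext => n.
by rewrite /flow_op !sato_lhs_wave !wave_op_dual orth_deriv.
Qed.

Local Notation B := (flow_op D S T).

Lemma flow_op_supp v n : fin_supp (fun j => B v j n).
Proof.
have Bo := ordle_flow_op derD wave_op_le dual_op_le flow_op_wave.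
apply: (@fin_suppP _ _ (- v.2.+1%:Z) v.2.+1%:Z) => j jv.
  by apply: (Bo v c2); move: jv; move: (v.2.+1) => P jv; rewrite /sg/=; lia.
by apply: (Bo v c1); move: jv; move: (v.2.+1) => P jv; rewrite /sg/=; lia.
Qed.

Lemma nabla_wave v a n :
  nabla D 1 v a (w a n) = fun k => \sum_(j \in [set: int]) B v j n * w a (n + j) k.
Proof.
apply/funext => k.
have := sato derD wave_op_le dual_op_le wave_op_dual2 flow_op_wave v a.
rewrite sato_lhs_wave => /(congr1 (fun A => A (k - n) n)).
rewrite /wave_op addrC subrK => ->.
by apply: eq_fsum => j; congr (_ * w a _ _); lia.
Qed.

Lemma nabla_dual v a n :
  nabla D (- 1) v a (ws a n) =
  fun k => \sum_(l \in [set: int]) - B v (n - l) (l - 1) * ws a l k.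
Proof.
apply/funext => k.
have := dual_sato derD wave_op_le dual_op_le wave_op_dual1 wave_op_dual2 flow_op_wave v a.
(* At these indices [dual_op a] is the coefficient of z^k in [ws a n]. *)
move=> /(congr1 (fun A => A (n - 1 + k) (- k))); rewrite /oadd => E.
have -> : nabla D (- 1) v a (ws a n) k = - omul (T a) (B v) (n - 1 + k) (- k).
  rewrite (canRL (addKr _) E) opprD opprK.
  rewrite /nabla /flow_sym /oder /dual_op addrC [in RHS]addrC; congr (_ + D v (ws a _ _)).
  - case: eqP => _; last by rewrite omul0l oppr0.
    by rewrite oLam_mulE mulN1r; congr (- ws a _ _); lia.
  - by lia.
  - by lia.
rewrite /omul (@reindex_fsum _ _ (fun l => l + k - 1) (fun l => l - k + 1)); last 2 first.
- by move=> l; lia.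
- by move=> l; lia.
rewrite -[LHS]mulN1r mulr_fsumr; apply: eq_fsum => l.
rewrite mulN1r mulNr mulrC /dual_op.
have -> : n - 1 + k - (l + k - 1) = n - l by lia.
have -> : - k + (l + k - 1) = l - 1 by lia.
have -> : l + k - 1 - k + 1 = l by lia.
by rewrite opprK.
Qed.

(** As [phi] does not depend on the index, the linear relation satisfied by the waves passes to
    their pairings with it. *)
Lemma flow_of_pairing v (g : int -> F) f (phi : bool -> int -> F) n :
  (forall a, ampl_le a f (phi a)) ->
  (forall l, g l = res (w c1 l) (phi c1) 0 + res (w c2 l) (phi c2) 0) ->
  D v (g n) = res (nabla D 1 v c1 (w c1 n)) (phi c1) 0
            + res (nabla D 1 v c2 (w c2 n)) (phi c2) 0 ->
  D v (g n) = oact (B v) g n.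
Proof.
move=> phif gE ->; rewrite !nabla_wave.
rewrite (pairing_fsum (y := fun a j => w a (n + j)) (flow_op_supp v n) _ phif (fun j => gE (n + j)))//.
by move=> a l; exists (n + l).
Qed.

(** The derivative of the dual wave n contains the dual wave l with coefficient - B_{n-l}(l - 1).
    Since l = n + i, this is minus the adjoint of B(n - 1), whence the shift by one in the equations
    for r. *)
Lemma dual_flow_of_pairing v (g : int -> F) f (phi : bool -> int -> F) n :
  (forall a, ampl_le a f (phi a)) ->
  (forall l, g l = res (ws c1 l) (phi c1) 0 + res (ws c2 l) (phi c2) 0) ->
  D v (g n) = res (nabla D (- 1) v c1 (ws c1 n)) (phi c1) 0
            + res (nabla D (- 1) v c2 (ws c2 n)) (phi c2) 0 ->
  D v (g n) = - oact (oadj (fun j n => B v j (n - 1))) g n.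
Proof.
move=> phif gE ->; rewrite !nabla_dual.
have Bo := ordle_flow_op derD wave_op_le dual_op_le flow_op_wave.
have cfin : fin_supp (fun l => - B v (n - l) (l - 1)).
  apply: (@fin_suppP _ _ (n - v.2.+1%:Z) (n + v.2.+1%:Z)) => j jv.
    by rewrite (Bo v c1) ?oppr0//; move: jv; move: (v.2.+1) => P jv; rewrite /sg/=; lia.
  by rewrite (Bo v c2) ?oppr0//; move: jv; move: (v.2.+1) => P jv; rewrite /sg/=; lia.
rewrite (pairing_fsum (y := ws) cfin _ phif gE); last first.
  by move=> a l; exists (1 - l).
rewrite /oact /oadj -[RHS]mulN1r mulr_fsumr.
rewrite (@reindex_fsum _ _ (fun i => n + i) (fun i => i - n)); last 2 first.
- by move=> l; lia.
- by move=> l; lia.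
apply: eq_fsum => i; rewrite mulN1r mulNr.
have -> : n - (n + i) = - i by lia.
by [].
Qed.

End WaveOperators.

(** * Wave functions of tau *)

Section ShiftInverses.
Variable F : idomainType.
Implicit Types (f : int -> int -> F) (a : bool).

Lemma fsum_nat_recl (g : nat -> F) : fin_supp g ->
  \sum_(i \in [set: nat]) g i = g 0%N + \sum_(i \in [set: nat]) g i.+1.
Proof.
move=> [A gA].
pose g0 i := if i == 0%N then g i else 0; pose g1 i := if i == 0%N then 0 else g i.
have -> : \sum_(i \in [set: nat]) g i = \sum_(i \in [set: nat]) (g0 i + g1 i).
  by apply: eq_fsum => i; rewrite /g0 /g1; case: eqP; rewrite ?addr0 ?add0r.
rewrite fsumD; last 2 first.
- by exists A => i /gA gi; rewrite /g0 gi if_same.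
- by exists A => i /gA gi; rewrite /g1 gi if_same.
congr (_ + _).
  by rewrite (@fsum1 _ _ _ 0%N) // => i /negPf i0; rewrite /g0 i0.
rewrite -(@fsbig_widen _ _ _ _ (succn @` [set: nat])) //.
  by rewrite fsbig_image// => i j _ _ [].
by move=> [|i] [_ /= iN]; [rewrite /g1|case: iN; exists i].
Qed.

Lemma iotaL_le a f n :
  (forall n k, 0 < sg a * (k + sg a * n) -> f n k = 0) -> ampl_le a (- sg a * n) (iotaL f n).
Proof.
move=> fa k kn; rewrite /iotaL fsum0 ?oppr0// => i; apply: fa.
by move: kn; case: (a); rewrite /sg; lia.
Qed.

(** For fixed k the bound on f leaves finitely many terms, so the sum is a genuine one and
    telescopes. *)
Lemma iotaL_step a f n k :
  (forall n k, 0 < sg a * (k + sg a * n) -> f n k = 0) ->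
  iotaL f (n + 1) k = iotaL f n k + f n k.
Proof.
move=> fa; rewrite {2}/iotaL fsum_nat_recl.
  rewrite addr0 opprD [RHS]addrC addrA subrr add0r /iotaL; congr (- _); apply: eq_fsum => i.
  by congr (f _ k); lia.
exists (seq_fset tt (iota 0 (`|k| + `|n|).+1)) => i; rewrite seq_fsetE mem_iota => ik.
by apply: fa; move: ik; case: (a); rewrite /sg; lia.
Qed.

Lemma iotaLV_le a f n :
  (forall n k, 0 < sg a * (k - sg a * n) -> f n k = 0) -> ampl_le a (sg a * n) (iotaLV f n).
Proof.
move=> fa k kn; rewrite /iotaLV fsum0// => i; apply: fa.
by move: kn; case: (a); rewrite /sg; lia.
Qed.

Lemma iotaLV_step a f n k :
  (forall n k, 0 < sg a * (k - sg a * n) -> f n k = 0) ->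
  iotaLV f (n + 1) k = iotaLV f n k + f n k.
Proof.
move=> fa; rewrite {1}/iotaLV fsum_nat_recl.
  rewrite [LHS]addrC addrK; congr (_ + _); apply: eq_fsum => i.
  by congr (f _ k); lia.
exists (seq_fset tt (iota 0 (`|k| + `|n|).+1)) => i; rewrite seq_fsetE mem_iota => ik.
by apply: fa; move: ik; case: (a); rewrite /sg; lia.
Qed.

End ShiftInverses.

(** * Leading terms of the waves built from tau *)

Section TauFunctions.
Variables (F : idomainType) (D : tvar -> F -> F) (tau : int -> F).
Hypothesis tau_unit : forall n, tau n \is a GRing.unit.
Implicit Types (a : bool).

Lemma mweight_eq0 (al : monom) : mweight al = 0%N -> al = mset0.
Proof. by elim/monom_ind: al => // x al _; rewrite mweight1D. Qed.

Lemma shift0 s a f : shift D s a f 0 = f.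
Proof.
rewrite /shift (_ : [set al | _] = [set mset0]).
  rewrite fsbig_set1 mdeg0 finsupp_mset0 big_seq_fset0 mderiv0 mfact0.
  by rewrite expr0 !mul1r divr1.
apply/seteqP; split=> [al [_ /mweight_eq0 ->]//|_ ->].
by split; rewrite ?in_comp0 ?mweight0.
Qed.

Definition wave a (n : int) : int -> F := if a then psi2 D tau n else psi1 D tau n.
Definition dual_wave a (n : int) : int -> F := if a then psi2s D tau n else psi1s D tau n.

Lemma wave_le a n : ampl_le a n (wave a n).
Proof. by case: a => k; rewrite /wave /psi1 /psi2 /zup /zdown /sg; case: ifP => //; lia. Qed.

Lemma dual_wave_le a n : ampl_le a (1 - n) (dual_wave a n).
Proof.
by case: a => k; rewrite /dual_wave /psi1s /psi2s /zup /zdown /sg; case: ifP => //; lia.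
Qed.

Lemma wave1_lead n : wave c1 n n = 1.
Proof. by rewrite /wave /= /psi1 /zdown lexx subrr shift0 divrr. Qed.

Lemma dual_wave1_lead n : dual_wave c1 n (1 - n) = 1.
Proof. by rewrite /dual_wave /= /psi1s /zdown [- n + 1]addrC lexx subrr shift0 divrr. Qed.

Lemma wave_lead a n : wave a n n \is a GRing.unit.
Proof.
case: a; last by rewrite wave1_lead unitr1.
by rewrite /wave /= /psi2 /zup lexx subrr shift0 unitrM unitrV !tau_unit.
Qed.

Lemma dual_wave_lead a n : dual_wave a n (1 - n) \is a GRing.unit.
Proof.
case: a; last by rewrite dual_wave1_lead unitr1.
by rewrite /dual_wave /= /psi2s /zup [- n + 1]addrC lexx subrr shift0 unitrM unitrV !tau_unit.
Qed.

Lemma wave_level n : level n (fun a => wave a n).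
Proof. by split=> a; [apply: wave_le|apply: wave_lead]. Qed.

Lemma dual_wave_level n : level (1 - n) (fun a => dual_wave a n).
Proof. by split=> a; [apply: dual_wave_le|apply: dual_wave_lead]. Qed.

(** The second factors of the two integrals in the equation for q at n'' = j, with the signs
    absorbed so that the equation becomes a sum of two pairings. *)
Definition q_phase (q : int -> F) (j : int) a : int -> F :=
  if a then iotaLV (fun n k => dual_wave c2 (n + 1) k * q n) j
  else fun k => - 1 * iotaL (fun n k => dual_wave c1 (n + 1) k * q n) j k.

Definition r_phase (r : int -> F) (j : int) a : int -> F :=
  if a then fun k => - 1 * iotaL (fun n k => wave c2 n k * r (n + 1)) j k
  else iotaLV (fun n k => wave c1 n k * r (n + 1)) j.

Let dual_bound a (q : int -> F) n k :
  0 < sg a * (k + n) -> dual_wave a (n + 1) k * q n = 0.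
Proof. by move=> kn; rewrite dual_wave_le ?mul0r//; move: kn; case: (a); rewrite /sg; lia. Qed.

Let wave_bound a (r : int -> F) n k : 0 < sg a * (k - n) -> wave a n k * r (n + 1) = 0.
Proof. by move=> kn; rewrite wave_le ?mul0r. Qed.

Lemma q_phase_le q j a : ampl_le a (- j) (q_phase q j a).
Proof.
case: a => k kj; rewrite /q_phase.
  apply: (@iotaLV_le _ c2) => [n i ni|]; last by move: kj; rewrite /sg/=; lia.
  by apply: (@dual_bound c2); move: ni; rewrite /sg/=; lia.
rewrite (@iotaL_le _ c1) ?mulr0// => [n i ni|]; last by move: kj; rewrite /sg/=; lia.
by apply: (@dual_bound c1); move: ni; rewrite /sg/=; lia.
Qed.

Lemma r_phase_le r j a : ampl_le a j (r_phase r j a).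
Proof.
case: a => k kj; rewrite /r_phase; last first.
  apply: (@iotaLV_le _ c1) => [n i ni|]; last by move: kj; rewrite /sg/=; lia.
  by apply: (@wave_bound c1); move: ni; rewrite /sg/=; lia.
rewrite (@iotaL_le _ c2) ?mulr0// => [n i ni|]; last by move: kj; rewrite /sg/=; lia.
by apply: (@wave_bound c2); move: ni; rewrite /sg/=; lia.
Qed.

Lemma q_phase_step q j a k : q_phase q (j + 1) a k =
  q_phase q j a k + (if a then - (- 1) else - 1) * q j * dual_wave a (j + 1) k.
Proof.
case: a; rewrite /q_phase.
  rewrite (@iotaLV_step _ c2) => [|n i ni]; last first.
    by apply: (@dual_bound c2); move: ni; rewrite /sg/=; lia.
  by rewrite opprK mul1r [q j * _]mulrC.
rewrite (@iotaL_step _ c1) => [|n i ni]; last first.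
  by apply: (@dual_bound c1); move: ni; rewrite /sg/=; lia.
by rewrite mulrDr -mulrA [q j * _]mulrC.
Qed.

Lemma r_phase_step r j a k : r_phase r (j + 1) a k =
  r_phase r j a k + (if a then - 1 else 1) * r (j + 1) * wave a j k.
Proof.
case: a; rewrite /r_phase.
  rewrite (@iotaL_step _ c2) => [|n i ni]; last first.
    by apply: (@wave_bound c2); move: ni; rewrite /sg/=; lia.
  by rewrite mulrDr -mulrA [r _ * _]mulrC.
rewrite (@iotaLV_step _ c1) => [|n i ni]; last first.
  by apply: (@wave_bound c1); move: ni; rewrite /sg/=; lia.
by rewrite mul1r [r _ * _]mulrC.
Qed.

End TauFunctions.

Arguments wave : simpl never.
Arguments dual_wave : simpl never.

(** * From one nonzero q or r to the 2-Toda bilinear equation *)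

Section BilinearIdentities.
Variables (F : idomainType) (D : tvar -> F -> F) (tau : int -> F).
Hypothesis charF : forall k : nat, (k.+1%:R : F) \is a GRing.unit.
Hypothesis derD : forall v : tvar, is_derivation (D v).
Hypothesis commD : forall (v w : tvar) (f : F), D v (D w f) = D w (D v f).
Hypothesis tau_unit : forall n, tau n \is a GRing.unit.

Local Notation w := (wave D tau).
Local Notation ws := (dual_wave D tau).
Local Notation q_phase := (q_phase D tau).
Local Notation r_phase := (r_phase D tau).

Definition q_bilinear (q : int -> F) : Prop := forall n j al,
  at_t' D (q n) al = wave_mul D 1 c1 (w c1 n) (q_phase q j c1) 0 al
                   + wave_mul D 1 c2 (w c2 n) (q_phase q j c2) 0 al.

Definition r_bilinear (r : int -> F) : Prop := forall n j al,
  at_t' D (r n) al = wave_mul D (- 1) c1 (ws c1 n) (r_phase r j c1) 0 al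
                   + wave_mul D (- 1) c2 (ws c2 n) (r_phase r j c2) 0 al.

Definition orthogonality : Prop := forall n n',
  res (w c1 n) (ws c1 n') 0 = res (w c2 n) (ws c2 n') 0.
Definition deriv_orthogonality : Prop := forall v n n',
  res (nabla D 1 v c1 (w c1 n)) (ws c1 n') 0 = res (nabla D 1 v c2 (w c2 n)) (ws c2 n') 0.

Let derN1 v : D v (- 1) = 0.
Proof. by apply: (addIr (D v 1)); rewrite -(tderD derD) addNr (tder1 derD) (tder0 derD) addr0. Qed.

Let rev_dual_le a n : ampl_le a n (ws a (1 - n)).
Proof. by have := @dual_wave_le F D tau a (1 - n); rewrite subKr. Qed.

Let rev_dual_lead a n : ws a (1 - n) n \is a GRing.unit.
Proof. by have := dual_wave_lead D tau_unit a (1 - n); rewrite subKr. Qed.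

Lemma orthogonality_q q n : q_bilinear q -> q n != 0 ->
  orthogonality /\ deriv_orthogonality.
Proof.
move=> Hq qn.
have qP := @q_phase_le F D tau q.
have xP j : level (- j) (fun a => ws a (j + 1)).
  by have := dual_wave_level D tau_unit (j + 1); rewrite opprD addrCA subrr addr0.
have N1u : (- 1 : F) \is a GRing.unit by rewrite unitrN1.
have stp := @q_phase_step F D tau q.
(* Here g and h are both q, so the same nonzero value yields the initial annihilator and the start
   of the propagation. *)
have qall := bilinear_nonvanishing charF derD commD (tder1 derD) (unitr1 F)
  (@wave_le F D tau) (wave_lead D tau_unit) N1u qP xP stp Hq qn qn.
have ann j := bilinear_annih charF derD commD (tder1 derD) (@wave_le F D tau) N1u qP xP stp
  Hq (qall j).
split=> [n1 n2|v n1 n2].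
  by have := ann (n2 - 1) n1 [::]; rewrite subrK.
by have := ann (n2 - 1) n1 [:: v]; rewrite subrK.
Qed.

(* The substitution n -> 1 - n, s -> - s exchanges the roles of psi and psi^*. *)
Lemma orthogonality_r r n : r_bilinear r -> r n != 0 ->
  orthogonality /\ deriv_orthogonality.
Proof.
move=> Hr rn.
have rP := @r_phase_le F D tau r.
have N1u : (- 1 : F) \is a GRing.unit by rewrite unitrN1.
have stp := @r_phase_step F D tau r.
have Hr' n' j al : at_t' D (r (1 - n')) al =
    wave_mul D (- 1) c1 (ws c1 (1 - n')) (r_phase r j c1) 0 al
    + wave_mul D (- 1) c2 (ws c2 (1 - n')) (r_phase r j c2) 0 al by [].
have rn' : (fun j => r (j + 1)) (n - 1) != 0 by rewrite /= subrK.
have rn'' : (fun j => r (1 - j)) (1 - n) != 0 by rewrite /= subKr.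
have rall := bilinear_nonvanishing charF derD commD derN1 N1u
  rev_dual_le rev_dual_lead (unitr1 F) rP (wave_level D tau_unit) stp Hr' rn' rn''.
have rall' j : (fun j => r (j + 1)) j != 0.
  by have := rall (- j); rewrite /= opprK addrC.
have ann j := bilinear_annih charF derD commD derN1 rev_dual_le (unitr1 F) rP
  (wave_level D tau_unit) stp Hr' (rall' j).
have orth : orthogonality.
  move=> n1 n2; have := ann n1 (1 - n2) [::]; rewrite /= subKr.
  by rewrite ![res (ws _ _) _ _]resC.
split=> [//|v n1 n2].
(* With the roles exchanged, the derivatives fall on the dual waves; differentiating the
   orthogonality relation moves them to the waves. *)
have E a := deriv_res derD 1 v 0 (@wave_le F D tau a n1) (@dual_wave_le F D tau a n2).
have := congr1 (D v) (orth n1 n2); rewrite !E.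
have := ann n1 (1 - n2) [:: v]; rewrite /= subKr.
by rewrite ![res (nabla _ _ _ _ (ws _ _)) _ _]resC => -> /addIr.
Qed.

End BilinearIdentities.

(** * The constraint and the flows of L, q and r *)

Theorem theorem7 (F : idomainType) (D : tvar -> F -> F)
  (charF : forall k : nat, (k.+1%:R : F) \is a GRing.unit)
  (derD : forall v : tvar, is_derivation (D v))
  (commD : forall (v w : tvar) (f : F), D v (D w f) = D w (D v f))
  (M N m : nat) (M1 : (1 <= M)%N) (N1 : (1 <= N)%N) (m1 : (1 <= m)%N)
  (tau0 : int -> F) (tau1 taum1 : 'I_m -> int -> F)
  (tau0_unit : forall n : int, tau0 n \is a GRing.unit)
  (tau_nontrivial : exists (i : 'I_m) (n : int),
     tau1 i n <> 0 \/ taum1 i n <> 0) :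
  let psi1 := psi1 D tau0 in
  let psi2 := psi2 D tau0 in
  let psi1s := psi1s D tau0 in
  let psi2s := psi2s D tau0 in
  let q (i : 'I_m) (n : int) : F := tau1 i n / tau0 n in
  let r (i : 'I_m) (n : int) : F := taum1 i n / tau0 n in
  (forall (n' n'' : int) (al : monom),
     \sum_(l < m) pmul (at_t' D (q l n')) (at_t'' (r l n'')) al =
     oint (M%:Z - 1) (wave_mul D 1 c1 (psi1 n') (psi1s n'')) al
     - oint (- N%:Z - 1) (wave_mul D 1 c2 (psi2 n') (psi2s n'')) al) ->
  (forall (i : 'I_m) (n' n'' : int) (al : monom),
     at_t' D (q i n') al =
     - oint (- 1) (wave_mul D 1 c1 (psi1 n')
         (iotaL (fun n k => psi1s (n + 1) k * q i n) n'')) al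
     + oint (- 1) (wave_mul D 1 c2 (psi2 n')
         (iotaLV (fun n k => psi2s (n + 1) k * q i n) n'')) al) ->
  (forall (i : 'I_m) (n' n'' : int) (al : monom),
     at_t' D (r i n') al =
     oint (- 1) (wave_mul D (- 1) c1 (psi1s n')
         (iotaLV (fun n k => psi1 n k * r i (n + 1)) n'')) al
     - oint (- 1) (wave_mul D (- 1) c2 (psi2s n')
         (iotaL (fun n k => psi2 n k * r i (n + 1)) n'')) al) ->
  forall omega nu : nat -> int -> F,
  (forall n : int, psi1 n = ozpow (S1op omega) n) ->
  (forall n : int, psi2 n = ozpow (S2op nu) n) ->
  let L1 := Lax1 (S1op omega) in
  let L2 := Lax2 (S2op nu) in
  (forall k n : int,
     oexp L1 M k n = oexp L2 N k n
       + \sum_(j \in [set: int]) \sum_(i < m)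
           omul (omul (omulf (q i)) (oLam F j))
                (omulf (fun n => r i (n + 1))) k n) /\
  (forall p : nat,
     let B1 := ogeq0 (oexp L1 p.+1) in
     let B2 := olt0 (oexp L2 p.+1) in
     let B1' := ogeq0 (opred (oexp L1 p.+1)) in
     let B2' := olt0 (opred (oexp L2 p.+1)) in
     (forall L : op F, L = L1 \/ L = L2 -> forall j n : int,
        oder D (c1, p) L j n = ocomm B1 L j n /\
        oder D (c2, p) L j n = ocomm B2 L j n) /\
     (forall (i : 'I_m) (n : int),
        D (c1, p) (q i n) = oact B1 (q i) n /\
        D (c2, p) (q i n) = oact B2 (q i) n /\
        D (c1, p) (r i n) = - oact (oadj B1') (r i) n /\
        D (c2, p) (r i n) = - oact (oadj B2') (r i) n)).

Proof.
move=> psi1 psi2 psi1s psi2s q r H1 H2 H3 omega nu Homega Hnu L1 L2.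
pose w := wave D tau0; pose ws := dual_wave D tau0.
have Hq i : q_bilinear D tau0 (q i).
  move=> n j al; rewrite (H2 i n j al) /oint (_ : - 1 - - 1 = 0); last by lia.
  by rewrite /q_phase /= wave_mulZr mulN1r.
have Hr i : r_bilinear D tau0 (r i).
  move=> n j al; rewrite (H3 i n j al) /oint (_ : - 1 - - 1 = 0); last by lia.
  by rewrite /r_phase /= wave_mulZr mulN1r.
have [orth orthD] : orthogonality D tau0 /\ deriv_orthogonality D tau0.
  have nz t n : t <> 0 -> t / tau0 n != 0.
    move=> /eqP t0; apply: contra_neq t0 => /(congr1 ( *%R^~ (tau0 n))).
    by rewrite divrK ?mul0r.
  have [i [n [t|t]]] := tau_nontrivial.
    exact (orthogonality_q charF derD commD tau0_unit (Hq i) (nz _ n t)).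
  exact (orthogonality_r charF derD commD tau0_unit (Hr i) (nz _ n t)).
have w_le := @wave_le F D tau0; have ws_le := @dual_wave_le F D tau0.
have w1 := wave1_lead D tau0_unit; have ws1 := dual_wave1_lead D tau0_unit.
have wu := wave_lead D tau0_unit.
pose S a := wave_op (w a); pose T := dual_op ws.
have S_le := wave_op_le w_le; have T_le := dual_op_le ws_le.
have ST := wave_op_dual1 w_le w1 ws_le ws1 orth.
have TS := wave_op_dual2 w_le wu w1 ws_le ws1 orth.
have XE := flow_op_wave orthD.
have L1E : L1 = lax S T c1.
  rewrite /L1 /Lax1; have -> : S1op omega = S c1.
    apply/funext => j; apply/funext => n; rewrite /S /wave_op /w /wave /= -/psi1 Homega.
    by rewrite /ozpow [n + j]addrC addrK.
  rewrite (oinvP (a := c1) (T := T c1) _ _ (S_le c1) (ST c1) (TS c1))//.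
  - by move=> A hA j n jn; apply: hA; move: jn; rewrite /sg/=; lia.
  - by move=> j n jn; apply: (T_le c1); rewrite /sg/=; lia.
have L2E : L2 = lax S T c2.
  rewrite /L2 /Lax2; have -> : S2op nu = S c2.
    apply/funext => j; apply/funext => n; rewrite /S /wave_op /w /wave /= -/psi2 Hnu.
    by rewrite /ozpow [n + j]addrC addrK.
  rewrite (oinvP (a := c2) (T := T c2) _ _ (S_le c2) (ST c2) (TS c2))//.
  - by move=> A hA j n jn; apply: hA; move: jn; rewrite /sg/=; lia.
  - by move=> j n jn; apply: (T_le c2); rewrite /sg/=; lia.
split=> [k n|p].
  have powE a d : oexp (lax S T a) d k n = res (w a n) (ws a (n + k + 1)) (- (sg a * d%:Z)).
    rewrite /lax (oexp_conj _ _ (S_le a) (T_le a) (ST a) (TS a)).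
    by rewrite wave_op_Lam_dual.
  rewrite L1E L2E !powE.
  (* At t' = t'' and n'' = n + k + 1 the two integrals are the coefficients of Lambda^k in L_1^M and
     L_2^N. *)
  have := H1 n (n + k + 1) mset0; rewrite /oint !wave_mul0.
  have -> : - 1 - (M%:Z - 1) = - (sg c1 * M%:Z) by rewrite /sg/=; lia.
  have -> : - 1 - (- N%:Z - 1) = - (sg c2 * N%:Z) by rewrite /sg/=; lia.
  move=> /(canLR (subrK _)) <-; rewrite addrC; congr (_ + _).
  (* The summand of index j is a multiple of Lambda^j, so each coefficient of the doubly infinite
     sum has a single term. *)
  rewrite (@fsum1 _ _ _ k) => [|j jk].
    apply: eq_bigr => i _; rewrite pmul_at_t mderiv0 mfact0 divr1.
    rewrite /omul (@fsum1 _ _ _ k) => [|l lk]; last first.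
      by rewrite /omulf subr_eq0 eq_sym (negPf lk) mulr0.
    rewrite (@fsum1 _ _ _ 0) => [|l l0]; last by rewrite /omulf (negPf l0) mul0r.
    by rewrite /omulf /oLam eqxx subr0 eqxx mulr1 subrr eqxx.
  rewrite big1// => i _; apply: fsum0 => l.
  rewrite /omul (@fsum1 _ _ _ 0) => [|l' l0]; last by rewrite /omulf (negPf l0) mul0r.
  rewrite /omulf /oLam eqxx subr0; case: (eqVneq l j) => [->|_].
    by rewrite subr_eq0 eq_sym (negPf jk) mulr0.
  by rewrite mulr0 mul0r.
move=> B1 B2 B1' B2'.
have B1E : B1 = flow_op D S T (c1, p).
  by rewrite (flow_op1 derD S_le T_le (wave_op_lead w1) ST TS XE) /B1 L1E.
have B2E : B2 = flow_op D S T (c2, p).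
  by rewrite (flow_op2 derD S_le T_le (wave_op_lead w1) ST TS XE) /B2 L2E.
split=> [L LL j n|i n].
  have [a ->] : exists a, L = lax S T a.
    by case: LL => ->; [exists c1|exists c2].
  have lx v : oder D v (lax S T a) j n = ocomm (flow_op D S T v) (lax S T a) j n.
    have /(congr1 (fun A => A j n)) := lax_eq derD S_le T_le ST TS XE v a.
    by rewrite /oadd /ocomm => <-; rewrite addrK.
  by rewrite B1E B2E; split; apply: lx.
have qf v : D v (q i n) = oact (flow_op D S T v) (q i) n.
  refine (flow_of_pairing derD w_le wu w1 ws_le ws1 orth orthD (@q_phase_le F D tau0 (q i) 0) _ _).
    by move=> l; apply: (pairing_eq (Hq i)).
  exact: (pairing_deriv charF derD commD (tder1 derD) w_le (@q_phase_le F D tau0 (q i)) (Hq i)).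
have derN1 v : D v (- 1) = 0.
  by apply: (addIr (D v 1)); rewrite -(tderD derD) addNr (tder1 derD) (tder0 derD) addr0.
have rf v : D v (r i n) = - oact (oadj (fun j n => flow_op D S T v j (n - 1))) (r i) n.
  refine (dual_flow_of_pairing derD w_le wu w1 ws_le ws1 orth orthD (@r_phase_le F D tau0 (r i) 0) _ _).
    by move=> l; apply: (pairing_eq (Hr i)).
  (* [pairing_deriv] expects waves of leading degree equal to their index, so the dual waves are
     reindexed by 1 - k and the result is used at 1 - n. *)
  have ws_le' a k : ampl_le a k (ws a (1 - k)).
    by have := ws_le a (1 - k); rewrite subKr.
  have Hr' k j al : at_t' D (r i (1 - k)) al =
      wave_mul D (- 1) c1 (ws c1 (1 - k)) (r_phase D tau0 (r i) j c1) 0 al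
      + wave_mul D (- 1) c2 (ws c2 (1 - k)) (r_phase D tau0 (r i) j c2) 0 al.
    exact: Hr.
  have := pairing_deriv charF derD commD derN1 ws_le' (@r_phase_le F D tau0 (r i)) Hr' v (1 - n) 0.
  by rewrite /= subKr.
by rewrite !qf !rf -B1E -B2E.
Qed.
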